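(* Let $\mathcal H$ be a separable infinite-dimensional complex Hilbert space. The set $$\mathcal C'=\{(P,Q): P,Q\in\mathcal P_\infty(\mathcal H),\ PQ\text{ is compact}\}$$ is a smooth ($C^\infty$) differentiable manifold.
   Context: $\mathcal P_\infty(\mathcal H)$ is the set of orthogonal projections of $\mathcal H$ with infinite-dimensional range and infinite-dimensional nullspace. $\mathcal C'$ is the set of pairs of orthogonal projections with compact product from which the pairs with $P$ or $Q$ of finite rank have been removed. ''Manifold'' means a Banach manifold, the topology of $\mathcal C'$ being the one induced by the operator norm of $\mathcal B(\mathcal H)\times\mathcal B(\mathcal H)$. *)

(* Defs.v *)
From HB Require Import structures.
From mathcomp Require Import all_boot all_order all_algebra.
From mathcomp Require Import complex sesquilinear.
From mathcomp Require Import all_classical all_reals all_analysis.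

Set Implicit Arguments.
Unset Strict Implicit.
Unset Printing Implicit Defensive.

Import Order.TTheory GRing.Theory Num.Theory.
Import numFieldNormedType.Exports.

Local Open Scope classical_set_scope.
Local Open Scope ring_scope.
Local Open Scope complex_scope.

Section sup_norm.
Variables (R : realType) (E : Type) (F : zmodType) (N : F -> R) (B : set E).

Lemma sup_norm_ub (f : E -> F) x : has_ubound [set N (f x) | x in B] ->
  B x -> N (f x) <= sup [set N (f x) | x in B].
Proof. by move=> ub Bx; apply: ub_le_sup => //; exists x. Qed.

Hypothesis B0 : B !=set0.

Lemma sup_normD (f g : E -> F) :
  (forall y z, N (y + z) <= N y + N z) ->
  has_ubound [set N (f x) | x in B] -> has_ubound [set N (g x) | x in B] ->
  sup [set N (f x + g x) | x in B] <=
  sup [set N (f x) | x in B] + sup [set N (g x) | x in B].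
Proof.
move=> ND uf ug; apply: ge_sup.
  by case: B0 => x Bx; exists (N (f x + g x)), x.
move=> _ [x Bx <-]; apply: le_trans (ND _ _) _.
by apply: lerD; apply: sup_norm_ub.
Qed.

Lemma sup_normZ (h : F -> F) (f : E -> F) a :
  0 <= a -> (forall y, N (h y) = a * N y) ->
  has_ubound [set N (f x) | x in B] ->
  sup [set N (h (f x)) | x in B] = a * sup [set N (f x) | x in B].
Proof.
move=> a0 Nh uf.
have [x0 Bx0] := B0.
apply/eqP; rewrite eq_le; apply/andP; split.
  apply: ge_sup; first by exists (N (h (f x0))), x0.
  by move=> _ [x Bx <-]; rewrite Nh ler_wpM2l// sup_norm_ub.
have [a_eq0|a_neq0] := eqVneq a 0.
  rewrite a_eq0 mul0r; apply: (@le_trans _ _ (N (h (f x0)))).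
    by rewrite Nh a_eq0 mul0r.
  apply: (@sup_norm_ub (h \o f)) => //; exists 0 => _ [x _ <-].
  by rewrite /= Nh a_eq0 mul0r.
have {a_neq0} a_gt0 : 0 < a by rewrite lt_def a_neq0.
rewrite -ler_pdivlMl//; apply: ge_sup; first by exists (N (f x0)), x0.
move=> _ [x Bx <-]; rewrite ler_pdivlMl// -Nh.
apply: (@sup_norm_ub (h \o f)) => //.
have [M uM] := uf; exists (a * M) => _ [z Bz <-] /=.
by rewrite Nh ler_wpM2l //; apply: uM; exists z.
Qed.

End sup_norm.

Section clin.
Variables (R : realType) (E F : normedModType R).

Definition clin_set : {pred E -> F} :=
  mem [set f : E -> F | linear f /\ continuous f].

Record clin := Clin { clin_fun :> E -> F; clin_funP : clin_fun \in clin_set }.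

HB.instance Definition _ := [isSub for clin_fun].
HB.instance Definition _ := [Choice of clin by <:].

Lemma clin_submod_closed : submod_closed clin_set.
Proof.
split; first by rewrite inE; split=> [a x y|x]; [rewrite scaler0 addr0|exact: cvg_cst].
move=> a f g; rewrite !inE => -[lf cf] [lg cg]; split=> [b x y|x].
  rewrite !fctE lf lg !scalerDr !scalerA (mulrC b a).
  by rewrite -!addrA; congr (_ + _); rewrite addrCA.
by apply: cvgD; [apply: cvgZr; exact: cf|exact: cg].
Qed.

HB.instance Definition _ :=
  GRing.isSubmodClosed.Build _ _ clin_set clin_submod_closed.
HB.instance Definition _ := [SubChoice_isSubLmodule of clin by <:].

Lemma clin_linear (f : clin) : linear f.
Proof. by case: f => g /= /set_mem[]. Qed.

HB.instance Definition _ (f : clin) :=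
  GRing.isLinear.Build R E F _ f (clin_linear f).

Lemma clin_continuous (f : clin) : continuous f.
Proof. by case: f => g /= /set_mem[]. Qed.

Definition clin_norm (f : clin) : R :=
  sup [set `|f x| | x in [set x : E | `|x| <= 1]].

Lemma clin_unit_ball0 : [set x : E | `|x| <= 1] !=set0.
Proof. by exists 0; rewrite /= normr0 ler01. Qed.

Lemma clin_ub (f : clin) : has_ubound [set `|f x| | x in [set x : E | `|x| <= 1]].
Proof.
have /linear_boundedP : bounded_near f (nbhs 0).
  by apply/linear_bounded_continuous; exact: clin_continuous.
move=> /pinfty_ex_gt0[r r0 gr]; exists r => _ [x /= x1 <-].
by rewrite (le_trans (gr x))// ler_piMr// ltW.
Qed.

Lemma clin_normD f g : clin_norm (f + g) <= clin_norm f + clin_norm g.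
Proof.
by apply: (sup_normD clin_unit_ball0 (@ler_normD _ _)); exact: clin_ub.
Qed.

Lemma clin_normZ a f : clin_norm (a *: f) = `|a| * clin_norm f.
Proof.
apply: (sup_normZ clin_unit_ball0 _ (normrZ a)) => //; exact: clin_ub.
Qed.

Lemma clin_norm0_eq0 f : clin_norm f = 0 -> f = 0.
Proof.
move=> f0; apply/val_inj/funext => x /=.
have [->|x0] := eqVneq x 0; first by rewrite linear0.
have : `|f (`|x|^-1 *: x)| <= 0.
  by rewrite -f0; apply: (sup_norm_ub (clin_ub f)); rewrite /= normfZV.
rewrite linearZ/= normrZ normfV normr_id pmulr_rle0 ?invr_gt0 ?normr_gt0//.
by rewrite normr_le0 => /eqP.
Qed.

HB.instance Definition _ := Lmodule_isNormed.Build R clin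
  clin_normD clin_normZ clin_norm0_eq0.

End clin.

Section smooth.
Variable R : realType.

(* The Frechet derivative as a map into the normed space of bounded linear
   maps; the default value 0 is only used where f is not differentiable. *)
Definition fderiv (E F : normedModType R) (f : E -> F) (x : E) : clin E F :=
  insubd (0 : clin E F) ('d f x : E -> F).

Lemma fderivE (E F : normedModType R) (f : E -> F) (x : E) :
  differentiable f x -> fderiv f x = 'd f x :> (E -> F).
Proof.
move=> fx; rewrite -[LHS]/(val _) insubdK// inE; split; first exact: linearP.
exact: diff_continuous.
Qed.

(* Meant for open U. *)
Fixpoint Ck (n : nat) (E F : normedModType R) (U : set E) (f : E -> F) : Prop :=
  match n with
  | 0 => forall x, U x -> {for x, continuous f}
  | n'.+1 => (forall x, U x -> differentiable f x) /\ Ck n' U (fderiv f)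
  end.

Definition smooth (E F : normedModType R) (U : set E) (f : E -> F) : Prop :=
  forall n, Ck n U f.

End smooth.

Section manifold.
Variables (R : realType) (M : topologicalType).

(* A homeomorphism from an open subset of M onto an open subset of a real
   Banach space; the model space may vary from chart to chart. *)
Record chart := Chart {
  model : completeNormedModType R;
  cdom : set M;
  ccod : set model;
  cmap : M -> model;
  cinv : model -> M;
  cdom_open : open cdom;
  ccod_open : open ccod;
  cmap_fun : set_fun cdom ccod cmap;
  cinv_fun : set_fun ccod cdom cinv;
  cmapK : forall x, cdom x -> cinv (cmap x) = x;
  cinvK : forall y, ccod y -> cmap (cinv y) = y;
  cmap_continuous : {within cdom, continuous cmap};
  cinv_continuous : {within ccod, continuous cinv} }.

Definition smooth_transition (c c' : chart) : Prop :=
  smooth (@cmap c @` (cdom c `&` cdom c')) (@cmap c' \o @cinv c).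

Definition smooth_atlas (I : Type) (c : I -> chart) : Prop :=
  (forall x, exists i, cdom (c i) x) /\
  (forall i j, smooth_transition (c i) (c j)).

Definition smooth_banach_manifold : Prop :=
  hausdorff_space M /\ exists (I : Type) (c : I -> chart), smooth_atlas c.

End manifold.

Section operators.
Variables (R : realType) (H : normedModType R[i]).

Definition bop_set : {pred H -> H} :=
  mem [set T : H -> H | linear T /\ exists M : R[i], forall x, `|T x| <= M * `|x|].

Record bop := Bop { bop_fun :> H -> H; bop_funP : bop_fun \in bop_set }.

HB.instance Definition _ := [isSub for bop_fun].
HB.instance Definition _ := [Choice of bop by <:].

Lemma bop_submod_closed : submod_closed bop_set.
Proof.
split.
  rewrite inE; split=> [a x y|]; first by rewrite scaler0 addr0.
  by exists 0 => x; rewrite normr0 mul0r.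
move=> a S T; rewrite !inE => -[lS [M SM]] [lT [M' TM]]; split=> [b x y|].
  rewrite !fctE lS lT !scalerDr !scalerA (mulrC b a).
  by rewrite -!addrA; congr (_ + _); rewrite addrCA.
exists (`|a| * M + M') => x; rewrite mulrDl -mulrA.
by apply: le_trans (ler_normD _ _) _; apply: lerD => //; rewrite normrZ ler_wpM2l.
Qed.

HB.instance Definition _ :=
  GRing.isSubmodClosed.Build _ _ bop_set bop_submod_closed.
HB.instance Definition _ := [SubChoice_isSubZmodule of bop by <:].

Lemma bop_linear (T : bop) : linear T.
Proof. by case: T => g /= /set_mem[]. Qed.

HB.instance Definition _ (T : bop) :=
  GRing.isLinear.Build R[i] H H _ T (bop_linear T).

Lemma bop_bounded (T : bop) : exists M : R[i], forall x, `|T x| <= M * `|x|.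
Proof. by case: T => g /= /set_mem[]. Qed.

(* Banach manifolds are modelled on real Banach spaces, so bop is given the
   structure of a normed space over R, not over R[i]. *)
Definition bop_scale (a : R) (T : bop) : bop :=
  Bop (rpredZ a%:C (bop_funP T)).

Fact bop_scaleA a b T : bop_scale a (bop_scale b T) = bop_scale (a * b) T.
Proof. by apply/val_inj; rewrite /= scalerA -rmorphM. Qed.

Fact bop_scale1 : left_id 1 bop_scale.
Proof. by move=> T; apply/val_inj; rewrite /= scale1r. Qed.

Fact bop_scaleDr : right_distributive bop_scale +%R.
Proof. by move=> a S T; apply/val_inj; rewrite /= scalerDr. Qed.

Fact bop_scaleDl T : {morph bop_scale^~ T : a b / a + b}.
Proof. by move=> a b; apply/val_inj; rewrite /= rmorphD scalerDl. Qed.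

HB.instance Definition _ := GRing.Zmodule_isLmodule.Build R bop
  bop_scaleA bop_scale1 bop_scaleDr bop_scaleDl.

(* The norm of H takes its values in the nonnegative reals of R[i]. *)
Definition opnorm (T : bop) : R :=
  sup [set complex.Re `|T x| | x in [set x : H | `|x| <= 1]].

Lemma bop_unit_ball0 : [set x : H | `|x| <= 1] !=set0.
Proof. by exists 0; rewrite /= normr0 ler01. Qed.

Lemma Re_normK (x : H) : (complex.Re `|x|)%:C = `|x|.
Proof. by rewrite RRe_real// normr_real. Qed.

Lemma bop_ub (T : bop) : has_ubound [set complex.Re `|T x| | x in [set x : H | `|x| <= 1]].
Proof.
have [M TM] := bop_bounded T.
exists (complex.Re `|M|) => _ [x /= x1 <-].
have : `|T x| <= `|M|.
  apply: le_trans (TM x) _.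
  have M0 : M * `|x| \is Num.real by rewrite ger0_real// (le_trans _ (TM x)).
  apply: le_trans (real_ler_norm M0) _.
  by rewrite normrM normr_id ler_piMr.
by rewrite lecE => /andP[].
Qed.

Lemma opnormD S T : opnorm (S + T) <= opnorm S + opnorm T.
Proof.
apply: (@sup_normD _ _ _ (fun y : H => complex.Re `|y|) _ bop_unit_ball0);
  [|exact: bop_ub..].
by move=> y z; rewrite -lecR rmorphD /= !Re_normK ler_normD.
Qed.

Lemma opnormZ a T : opnorm (a *: T) = `|a| * opnorm T.
Proof.
apply: (@sup_normZ _ _ _ (fun y : H => complex.Re `|y|) _ bop_unit_ball0
  (fun y => a%:C *: y)) => //; last exact: bop_ub.
move=> y; apply: complexI; rewrite rmorphM /= !Re_normK normrZ normc_def /=.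
by rewrite expr0n addr0 sqrtr_sqr.
Qed.

Lemma opnorm0_eq0 T : opnorm T = 0 -> T = 0.
Proof.
move=> T0; apply/val_inj/funext => x /=.
have [->|x0] := eqVneq x 0; first by rewrite linear0.
have : complex.Re `|T (`|x|^-1 *: x)| <= 0.
  rewrite -T0; apply: (@sup_norm_ub _ _ _ (fun y : H => complex.Re `|y|) _ _ _ (bop_ub T)).
  by rewrite /= normfZV.
rewrite -lecR Re_normK linearZ/= normrZ normfV normr_id.
rewrite pmulr_rle0 ?invr_gt0 ?normr_gt0//.
by rewrite normr_le0 => /eqP.
Qed.

HB.instance Definition _ := Lmodule_isNormed.Build R bop
  opnormD opnormZ opnorm0_eq0.

End operators.

Section projections.
Variables (R : realType) (H : completeNormedModType R[i]).

Definition finite_dimensional (V : set H) : Prop :=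
  exists (n : nat) (e : 'I_n -> H),
    V = [set x | exists a : 'I_n -> R[i], x = \sum_(i < n) a i *: e i].

Definition compact_operator (T : H -> H) : Prop :=
  precompact (T @` [set x : H | `|x| <= 1]).

Variable dot : {dot H for Num.conj}.

Definition orthogonal_projection (P : bop H) : Prop :=
  (forall x, P (P x) = P x) /\ (forall x y, dot (P x) y = dot x (P y)).

Definition Pinf : set (bop H) :=
  [set P | [/\ orthogonal_projection P,
               ~ finite_dimensional (range P) &
               ~ finite_dimensional [set x | P x = 0]]].

Definition Cprime : set (bop H * bop H) :=
  [set PQ | [/\ Pinf PQ.1, Pinf PQ.2 & compact_operator (PQ.1 \o PQ.2)]].

End projections.

(* Main.v *)
(* Near an orthogonal projection [p], every orthogonal projection is that onto
   the graph of an operator between the range and the kernel of [p], that is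
   [g p g^-1] with [g = 1 + S (2 p - 1)] for a self-adjoint [S] with
   [p S + S p = S].  Conversely [S = (P - p) (P + p - 1)^-1 (2 p - 1)], so this
   is a smooth chart of the set of projections.  For the graphs [P] of [S] over
   [p] and [Q] of [T] over [q], where [p q] is compact, [P Q] is compact if and
   only if [p (1 + S) (1 + T) q] is, which is a quadratic condition on [(S, T)].
   Replacing the corner [T q] of [T] by [(1 + n) T q + n q], where
   [n = (1 - q) p S] is small, is an invertible affine shear that turns the
   condition into the linear one "[p Y q] is compact".  So the pairs near
   [(p, q)] are parametrised by an open subset of a closed real subspace of
   pairs of operators.  All maps involved are built from sums, products and
   inverses of bounded operators, hence are smooth; the subspace need not be
   complemented, so corestricting the transition maps to it uses that
   derivatives take their values in closed subspaces. *)
Require Import Defs.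
From HB Require Import structures.
From mathcomp Require Import all_boot all_order all_algebra.
From mathcomp Require Import complex sesquilinear.
From mathcomp Require Import all_classical all_reals all_analysis.
From mathcomp Require Import ring.

Set Implicit Arguments.
Unset Strict Implicit.
Unset Printing Implicit Defensive.

Import Order.TTheory GRing.Theory Num.Theory.
Import numFieldNormedType.Exports.

Local Open Scope classical_set_scope.
Local Open Scope ring_scope.
Local Open Scope complex_scope.

(** * Calculus of [Ck] maps *)

Section clin_bounds.
Variables (R : realType) (E F : normedModType R).

Lemma clin_norm_bound (f : clin E F) x : `|f x| <= `|f| * `|x|.
Proof.
have [->|x0] := eqVneq x 0; first by rewrite linear0 !normr0 mulr0.
have xgt0 : 0 < `|x| by rewrite normr_gt0.
rewrite -ler_pdivrMr//.
have -> : `|f x| / `|x| = `|f (`|x|^-1 *: x)|.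
  by rewrite linearZ normrZ normfV normr_id mulrC.
by apply: (sup_norm_ub (clin_ub f)); rewrite /= normfZV.
Qed.

Lemma clin_norm_le (f : clin E F) C :
  0 <= C -> (forall x, `|f x| <= C * `|x|) -> `|f| <= C.
Proof.
move=> C0 fC; apply: ge_sup; first by have [x Bx] := clin_unit_ball0 E; exists `|f x|, x.
by move=> _ [x /= x1 <-]; apply: le_trans (fC x) _; rewrite ler_piMr.
Qed.

Lemma bounded_clin_set (f : E -> F) C :
  linear f -> (forall x, `|f x| <= C * `|x|) -> f \in @clin_set R E F.
Proof.
move=> lf fC; rewrite inE; split => //.
pose f' : {linear E -> F} := HB.pack f (GRing.isLinear.Build R E F _ f lf).
apply: (@bounded_linear_continuous _ _ _ f').
apply/linear_boundedP; near=> r => x; apply: le_trans (fC x) _.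
by apply: ler_wpM2r => //; near: r; apply: nbhs_pinfty_ge; rewrite num_real.
Unshelve. all: by end_near. Qed.

Definition mkclin (f : E -> F) C (lf : linear f) (fC : forall x, `|f x| <= C * `|x|) :
  clin E F := Clin (bounded_clin_set lf fC).

(** The derivative as a relation with a named candidate [L], in epsilon form: such estimates add,
    multiply and localise directly, and [has_fderivP] turns them back into statements about
    [fderiv]. *)
Definition has_fderiv (f : E -> F) (x : E) (L : clin E F) :=
  forall e, 0 < e -> \forall y \near x, `|f y - f x - L (y - x)| <= e * `|y - x|.

Lemma fderiv_has (f : E -> F) x : differentiable f x -> has_fderiv f x (fderiv f x).
Proof.
move=> fx e e0; have := fx => /diff_locallyP[_ /eqaddoP H].
have := H _ e0; rewrite (near_shift 0 x); apply: filterS => y /=.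
by rewrite !subr0 addrK fderivE// opprD addrA.
Qed.

Lemma has_fderivP (f : E -> F) x (L : clin E F) : has_fderiv f x L ->
  differentiable f x /\ fderiv f x = L.
Proof.
move=> fL.
have H : f \o shift x = cst (f x) + L +o_ (0 : E) id.
  apply/eqaddoP => e e0; have := fL e e0.
  rewrite (near_shift 0 x); apply: filterS => y /=.
  by rewrite subr0 addrK -[(_ + _) y]/(_ + _) opprD addrA.
have dE : 'd f x = L :> (E -> F) by apply: diff_unique => //; exact: clin_continuous.
have df : differentiable f x.
  apply/diff_locallyP; split; last by rewrite dE.
  by rewrite dE; exact: clin_continuous.
by split => //; apply/val_inj => /=; rewrite -dE -fderivE.
Qed.

End clin_bounds.

Lemma has_fderiv_eq_near (R : realType) (E F : normedModType R) (f g : E -> F)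
    (x : E) (L : clin E F) :
  (\forall y \near x, f y = g y) -> has_fderiv f x L -> has_fderiv g x L.
Proof.
move=> fg fL e e0; have fgx := nbhs_singleton fg.
by apply: filterS2 fg (fL e e0) => y <-; rewrite fgx.
Qed.

Lemma has_fderiv_lipschitz (R : realType) (E F : normedModType R) (f : E -> F)
    (x : E) (L : clin E F) : has_fderiv f x L ->
  \forall y \near x, `|f y - f x| <= (`|L| + 1) * `|y - x|.
Proof.
move=> fL; apply: filterS (fL 1 ltr01) => y H.
rewrite -[f y - f x](subrK (L (y - x))).
apply: le_trans (ler_normD _ _) _; rewrite addrC mulrDl.
by apply: lerD => //; exact: clin_norm_bound.
Qed.

Lemma has_fderiv_cst (R : realType) (E F : normedModType R) (c : F) (x : E) :
  has_fderiv (fun=> c) x (0 : clin E F).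
Proof. by move=> e e0; apply: nearW => y; rewrite !subrr normr0 mulr_ge0// ltW. Qed.

Lemma has_fderiv_clin (R : realType) (E F : normedModType R) (L : clin E F) x :
  has_fderiv L x L.
Proof.
by move=> e e0; apply: nearW => y; rewrite linearB /= subrr normr0 mulr_ge0// ltW.
Qed.

Lemma has_fderivD (R : realType) (E F : normedModType R) (f g : E -> F) x
    (L M : clin E F) :
  has_fderiv f x L -> has_fderiv g x M -> has_fderiv (fun y => f y + g y) x (L + M).
Proof.
move=> fL gM e e0.
have e2 : 0 < e / 2 by rewrite divr_gt0.
apply: filterS2 (fL _ e2) (gM _ e2) => y H1 H2.
rewrite [e]splitr mulrDl; apply: le_trans (lerD H1 H2).
apply: le_trans (ler_normD _ _); rewrite le_eqVlt; apply/orP; left; apply/eqP.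
rewrite -[(L + M) _]/(_ + _) !opprD [in RHS]addrACA; congr (`|_ + _|); exact: addrACA.
Qed.

Section clin_comp.
Variables (R : realType) (E F G : normedModType R).

Fact clin_comp_subproof (M : clin F G) (L : clin E F) : M \o L \in @clin_set R E G.
Proof.
rewrite inE; split; first by move=> a x y; rewrite /= !linearP.
move=> x.
apply: (@continuous_comp _ _ _ L M x).
  exact: (@clin_continuous _ _ _ L).
exact: (@clin_continuous _ _ _ M).
Qed.

Definition clin_comp (M : clin F G) (L : clin E F) : clin E G :=
  Clin (clin_comp_subproof M L).

Lemma has_fderiv_comp (f : E -> F) (g : F -> G) x L M :
  has_fderiv f x L -> has_fderiv g (f x) M -> has_fderiv (g \o f) x (clin_comp M L).
Proof.
move=> /has_fderivP[df <-] /has_fderivP[dg <-].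
have -> : clin_comp (fderiv g (f x)) (fderiv f x) = fderiv (g \o f) x.
  apply/val_inj => /=; rewrite !fderivE//; last exact: differentiable_comp.
  by rewrite [RHS]diff_comp.
by apply: fderiv_has; exact: differentiable_comp.
Qed.

End clin_comp.

(* A bounded bilinear map carries a bound as data, so that the bilinear maps
   derived from it below can be built without choice. *)
Record bbil (R : realType) (E F G : normedModType R) := Bbil {
  bbil_fun :> E -> F -> G;
  bbil_cst : R;
  bbil_linearl : forall y, linear (bbil_fun^~ y);
  bbil_linearr : forall x, linear (bbil_fun x);
  bbil_bound : forall x y, `|bbil_fun x y| <= bbil_cst * `|x| * `|y| }.

Section bbil_theory.
Variables (R : realType) (E F G : normedModType R) (B : bbil E F G).

Definition bbil_pos : R := `|bbil_cst B|.

Lemma bbil_pos_ge0 : 0 <= bbil_pos. Proof. exact: normr_ge0. Qed.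

Lemma bbil_bound_pos x y : `|B x y| <= bbil_pos * `|x| * `|y|.
Proof.
apply: le_trans (bbil_bound B x y) _; rewrite -!mulrA ler_wpM2r ?mulr_ge0//.
exact: ler_norm.
Qed.

Definition bbil_left (x : E) : clin F G :=
  mkclin (bbil_linearr B x) (bbil_bound_pos x).

Fact bbil_right_bound y x : `|B x y| <= (bbil_pos * `|y|) * `|x|.
Proof. by rewrite mulrAC bbil_bound_pos. Qed.

Definition bbil_right (y : F) : clin E G :=
  mkclin (bbil_linearl B y) (bbil_right_bound y).

Lemma bbilBl y : {morph B^~ y : x x' / x - x'}.
Proof. exact: (linearB (bbil_right y)). Qed.

Lemma bbilBr x : {morph B x : y y' / y - y'}.
Proof. exact: (linearB (bbil_left x)). Qed.

Lemma bbilDr x : {morph B x : y y' / y + y'}.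
Proof. exact: (linearD (bbil_left x)). Qed.

(** Leibniz rule. The remainder splits into [B] of [f x] and the remainder of [g], [B] of the
    remainder of [f] and [g x], and [B] of the two increments; the last is small because [f] is
    Lipschitz at [x] and [g] is continuous there. *)
Lemma has_fderiv_bbil (X : normedModType R) (f : X -> E) (g : X -> F) x L M :
  has_fderiv f x L -> has_fderiv g x M ->
  has_fderiv (fun y => B (f y) (g y)) x
    (clin_comp (bbil_left (f x)) M + clin_comp (bbil_right (g x)) L).
Proof.
move=> fL gM e e0.
pose C := bbil_pos; have C0 : 0 <= C := bbil_pos_ge0.
(* [K] adds up the coefficients of the three error terms; the final 1 keeps it positive, so that
   [d = e / K] can serve as common tolerance. *)
pose K := C * `|f x| + C * `|g x| + C * (`|L| + 1) + 1.
have K0 : 0 < K by rewrite ltr_pwDr// !addr_ge0// mulr_ge0// addr_ge0.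
have [d d0 dK] : exists2 d, 0 < d & d * K = e.
  by exists (e / K); rewrite ?divr_gt0// divfK// gt_eqF.
have cg : \forall y \near x, `|g y - g x| <= d.
  have [dg _] := has_fderivP gM; have /cvgrPdist_le/(_ _ d0) := differentiable_continuous dg.
  by apply: filterS => y; rewrite distrC.
near=> y.
have -> : B (f y) (g y) - B (f x) (g x) -
    (clin_comp (bbil_left (f x)) M + clin_comp (bbil_right (g x)) L) (y - x) =
    B (f x) (g y - g x - M (y - x)) + B (f y - f x - L (y - x)) (g x) +
    B (f y - f x) (g y - g x).
  rewrite [B (f x) (_ - M _)]bbilBr [B (f y - f x - _) _]bbilBl addrACA -opprD.
  rewrite [RHS]addrAC; congr (_ - _).
  by rewrite -addrA -bbilDr [g x + _]addrC subrK bbilBr bbilBl addrC subrKA.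
apply: le_trans (ler_normD _ _) _.
apply: le_trans (lerD (ler_normD _ _) (lexx _)) _.
apply: (@le_trans _ _ ((C * `|f x| + C * `|g x| + C * (`|L| + 1)) * (d * `|y - x|))); last first.
  rewrite -dK [d * K]mulrC -mulrA ler_wpM2r ?mulr_ge0 ?(ltW d0)//.
  by rewrite /K lerDl.
rewrite [X in _ <= X]mulrDl [X in _ <= X + _]mulrDl; apply: lerD; first apply: lerD.
- apply: le_trans (bbil_bound_pos _ _) _; rewrite -!mulrA !ler_wpM2l//.
  by near: y; exact: gM.
- apply: le_trans (bbil_bound_pos _ _) _; rewrite -!mulrA !ler_wpM2l//.
  by rewrite mulrC ler_wpM2l//; near: y; exact: fL.
- apply: le_trans (bbil_bound_pos _ _) _; rewrite -!mulrA !ler_wpM2l//.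
  rewrite mulrCA mulrC; apply: ler_pM => //; near: y; first exact: cg.
  exact: has_fderiv_lipschitz.
Unshelve. all: by end_near. Qed.

End bbil_theory.

(** * Closure properties of [Ck] maps *)

Section Ck.
Variable R : realType.
Implicit Types E F G X : normedModType R.

(** On an open [U], equality on [U] is equality near each point of [U], so the derivatives agree on
    [U] as well and the induction goes through. *)
Lemma Ck_eq n E F (U : set E) (f g : E -> F) : open U ->
  (forall x, U x -> f x = g x) -> Ck n U f -> Ck n U g.
Proof.
elim: n F f g => [|n IH] F f g oU fg /=.
  move=> cf x Ux; have nU := open_nbhs_nbhs (conj oU Ux).
  have : f @ x --> g x by rewrite -fg//; exact: cf.
  apply: cvg_trans.
  by apply: near_eq_cvg; apply: filterS nU => y /fg.
move=> [df Cf].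
have H x : U x -> has_fderiv g x (fderiv f x).
  move=> Ux; apply: (has_fderiv_eq_near _ (fderiv_has (df x Ux))).
  by apply: filterS (open_nbhs_nbhs (conj oU Ux)) => y /fg.
split; first by move=> x /H/has_fderivP[].
apply: (IH _ (fderiv f) (fderiv g) oU _ Cf) => x /H /has_fderivP[_ <-].
by [].
Qed.

Lemma Ck_sub n E F (U V : set E) (f : E -> F) : V `<=` U -> Ck n U f -> Ck n V f.
Proof.
move=> VU; elim: n F f => [|n IH] F f /=; first by move=> cf x /VU /cf.
by move=> [df Cf]; split; [move=> x /VU /df|exact: IH].
Qed.

(** Allows any formula [D] for the derivative that is valid on [U], in place of [fderiv f], whose
    values outside [U] are not controlled. *)
Lemma Ck_has_fderiv n E F (U : set E) (f : E -> F) (D : E -> clin E F) : open U ->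
  (forall x, U x -> has_fderiv f x (D x)) -> Ck n U D -> Ck n.+1 U f.
Proof.
move=> oU fD CD; split; first by move=> x /fD /has_fderivP[].
by apply: Ck_eq CD => // x /fD /has_fderivP[].
Qed.

Lemma CkS_has n E F (U : set E) (f : E -> F) : Ck n.+1 U f ->
  forall x, U x -> has_fderiv f x (fderiv f x).
Proof. by move=> [df _] x /df /fderiv_has. Qed.

Lemma Ck_continuous n E F (U : set E) (f : E -> F) : Ck n U f ->
  forall x, U x -> {for x, continuous f}.
Proof.
by case: n => [|n] //= [df _] x /df /differentiable_continuous.
Qed.

Lemma CkS n E F (U : set E) (f : E -> F) : Ck n.+1 U f -> Ck n U f.
Proof.
elim: n F f => [|n IH] F f; first exact: Ck_continuous.
by move=> [df Cf]; split => //; exact: IH.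
Qed.

Lemma Ck_cst n E F (U : set E) (c : F) : open U -> Ck n U (fun=> c).
Proof.
elim: n F c => [|n IH] F c oU; first by move=> x _; exact: cvg_cst.
by apply: (Ck_has_fderiv oU (fun x _ => @has_fderiv_cst _ E F c x)); exact: IH.
Qed.

Lemma Ck_clin n E F (U : set E) (L : clin E F) : open U -> Ck n U L.
Proof.
case: n => [|n] oU; first by move=> x _; exact: clin_continuous.
by apply: (Ck_has_fderiv oU (fun x _ => has_fderiv_clin L x)); exact: Ck_cst.
Qed.

Lemma CkD n E F (U : set E) (f g : E -> F) : open U ->
  Ck n U f -> Ck n U g -> Ck n U (fun x => f x + g x).
Proof.
move=> oU; elim: n F f g => [|n IH] F f g Cf Cg.
  by move=> x Ux; apply: cvgD; [exact: Cf|exact: Cg].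
apply: (@Ck_has_fderiv n _ _ _ _ (fun x => fderiv f x + fderiv g x)) => //.
  by move=> x Ux; apply: has_fderivD; [exact: (CkS_has Cf Ux)|exact: (CkS_has Cg Ux)].
by apply: IH; [case: Cf|case: Cg].
Qed.

End Ck.

Section bbil_comp.
Variables (R : realType) (E F G : normedModType R).

Fact clin_comp_bilinear_bound (M : clin F G) (L : clin E F) :
  `|clin_comp M L| <= 1 * `|M| * `|L|.
Proof.
rewrite mul1r; apply: clin_norm_le; first by rewrite mulr_ge0.
move=> x; apply: le_trans (clin_norm_bound M _) _.
by rewrite -mulrA ler_wpM2l// clin_norm_bound.
Qed.

Fact clin_comp_linearl (L : clin E F) : linear ((@clin_comp R E F G)^~ L).
Proof. by move=> a M N; apply/val_inj. Qed.

Fact clin_comp_linearr (M : clin F G) : linear (@clin_comp R E F G M).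
Proof. by move=> a L N; apply/val_inj/funext => x; rewrite /= linearP. Qed.

Definition bbil_comp : bbil (clin F G) (clin E F) (clin E G) :=
  Bbil clin_comp_linearl clin_comp_linearr clin_comp_bilinear_bound.

End bbil_comp.

Section bbil_derived.
Variables (R : realType) (E F G X : normedModType R) (B : bbil E F G).

Fact bbil_compr_linearl (L : clin X F) : linear (fun x => clin_comp (bbil_left B x) L).
Proof. by move=> a x y; apply/val_inj/funext => z /=; rewrite bbil_linearl. Qed.

Fact bbil_compr_linearr (x : E) :
  linear (fun L : clin X F => clin_comp (bbil_left B x) L).
Proof. exact: clin_comp_linearr. Qed.

Fact bbil_compr_bound (x : E) (L : clin X F) :
  `|clin_comp (bbil_left B x) L| <= bbil_pos B * `|x| * `|L|.
Proof.
apply: clin_norm_le; first by rewrite !mulr_ge0// bbil_pos_ge0.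
move=> z /=; apply: le_trans (bbil_bound_pos B _ _) _.
by rewrite -!mulrA !ler_wpM2l ?bbil_pos_ge0// clin_norm_bound.
Qed.

(** Together with [bbil_compl], the two terms of the Leibniz rule, each again a bounded bilinear
    map, now with values in a space of linear maps. *)
Definition bbil_compr : bbil E (clin X F) (clin X G) :=
  Bbil bbil_compr_linearl bbil_compr_linearr bbil_compr_bound.

Fact bbil_compl_linearl (y : F) :
  linear (fun L : clin X E => clin_comp (bbil_right B y) L).
Proof. exact: clin_comp_linearr. Qed.

Fact bbil_compl_linearr (L : clin X E) : linear (fun y => clin_comp (bbil_right B y) L).
Proof. by move=> a x y; apply/val_inj/funext => z /=; rewrite bbil_linearr. Qed.

Fact bbil_compl_bound (L : clin X E) (y : F) :
  `|clin_comp (bbil_right B y) L| <= bbil_pos B * `|L| * `|y|.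
Proof.
apply: clin_norm_le; first by rewrite !mulr_ge0// bbil_pos_ge0.
move=> z /=; apply: le_trans (bbil_bound_pos B _ _) _.
rewrite [X in _ <= X]mulrAC ler_wpM2r// -mulrA ler_wpM2l ?bbil_pos_ge0//.
exact: clin_norm_bound.
Qed.

Definition bbil_compl : bbil (clin X E) F (clin X G) :=
  @Bbil _ _ _ _ (fun L y => clin_comp (bbil_right B y) L) _
    bbil_compl_linearl bbil_compl_linearr bbil_compl_bound.

End bbil_derived.

Section Ck_bbil.
Variable R : realType.
Implicit Types E F G X : normedModType R.

(** Induction on [n] for all bounded bilinear maps at once: the derivative is a sum of two bounded
    bilinear expressions in [f], [g] and their derivatives, all of class [n]. *)
Lemma Ck_bbil n X E F G (U : set X) (B : bbil E F G) f g : open U ->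
  Ck n U f -> Ck n U g -> Ck n U (fun x => B (f x) (g x)).
Proof.
move=> oU; elim: n E F G B f g => [|n IH] E F G B f g Cf Cg.
  move=> x Ux.
  apply/cvgrPdist_le => e e0.
  pose C := bbil_pos B; have C0 : 0 <= C := bbil_pos_ge0 B.
  pose K := C * (`|f x| + 1) + C * `|g x| + 1.
  have K0 : 0 < K by rewrite ltr_pwDr// !addr_ge0// mulr_ge0// addr_ge0.
  have [d d0 dK] : exists2 d, 0 < d & d * K = e.
    by exists (e / K); rewrite ?divr_gt0// divfK// gt_eqF.
  near=> y.
  have -> : B (f x) (g x) - B (f y) (g y) =
      B (f y) (g x - g y) + B (f x - f y) (g x).
    by rewrite bbilBl bbilBr [RHS]addrC addrA subrK.
  apply: le_trans (ler_normD _ _) _.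
  apply: (@le_trans _ _ ((C * (`|f x| + 1) + C * `|g x|) * d)); last first.
    by rewrite -dK [d * K]mulrC ler_wpM2r ?(ltW d0)// /K lerDl.
  rewrite [X in _ <= X]mulrDl; apply: lerD; apply: le_trans (bbil_bound_pos _ _ _) _.
    rewrite -!mulrA ler_wpM2l//; apply: ler_pM => //; last first.
      by near: y; exact: (cvgrPdist_le _ _).1 (Cg x Ux) _ d0.
    rewrite -lerBlDl; apply: le_trans (lerB_dist _ _) _; rewrite distrC.
    by near: y; exact: (cvgrPdist_le _ _).1 (Cf x Ux) _ ltr01.
  rewrite -!mulrA ler_wpM2l// mulrC ler_wpM2l//.
  by near: y; exact: (cvgrPdist_le _ _).1 (Cf x Ux) _ d0.
apply: (@Ck_has_fderiv _ n _ _ _ _ (fun x => bbil_compr X B (f x) (fderiv g x) +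
   bbil_compl X B (fderiv f x) (g x))) => //.
  by move=> x Ux; apply: has_fderiv_bbil; [exact: (CkS_has Cf Ux)|exact: (CkS_has Cg Ux)].
apply: CkD => //; apply: IH; by [exact: CkS|case: Cf|case: Cg].
Unshelve. all: by end_near. Qed.

(** By the chain rule the derivative is the bilinear [bbil_comp] of [fderiv g \o f] and [fderiv f];
    the former is of class [n] by induction, since [f] is in particular of class [n]. *)
Lemma Ck_comp n E F G (U : set E) (V : set F) (f : E -> F) (g : F -> G) :
  open U -> (forall x, U x -> V (f x)) ->
  Ck n U f -> Ck n V g -> Ck n U (g \o f).
Proof.
move=> oU fUV; elim: n G g => [|n IH] G g Cf Cg.
  by move=> x Ux; apply: continuous_comp; [exact: Cf|apply: Cg; exact: fUV].
apply: (@Ck_has_fderiv _ n _ _ _ _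
  (fun x => bbil_comp E F G (fderiv g (f x)) (fderiv f x))) => //.
  move=> x Ux; apply: has_fderiv_comp; first exact: (CkS_has Cf Ux).
  exact: (CkS_has Cg (fUV _ Ux)).
apply: (@Ck_bbil n _ _ _ _ _ _ (fderiv g \o f)) => //; last by case: Cf.
by apply: IH; [exact: CkS|case: Cg].
Qed.

Lemma Ck_clin_comp n E F G (U : set E) (f : E -> F) (L : clin F G) :
  open U -> Ck n U f -> Ck n U (L \o f).
Proof. by move=> oU Cf; apply: (@Ck_comp _ _ _ _ _ setT) => //; exact: (Ck_clin _ _ openT). Qed.

End Ck_bbil.

(** * Products of normed spaces *)

Section pairs.
Variables (R : realType) (E F G : normedModType R).

Fact clin_fst_subproof : (@fst F G) \in @clin_set R (F * G)%type F.
Proof. by rewrite inE; split=> [a x y //|x]; exact: cvg_fst. Qed.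
Definition clin_fst : clin (F * G)%type F := Clin clin_fst_subproof.

Fact clin_snd_subproof : (@snd F G) \in @clin_set R (F * G)%type G.
Proof. by rewrite inE; split=> [a x y //|x]; exact: cvg_snd. Qed.
Definition clin_snd : clin (F * G)%type G := Clin clin_snd_subproof.

Fact clin_inl_subproof : (fun x : F => (x, 0 : G)) \in @clin_set R F (F * G)%type.
Proof.
rewrite inE; split=> [a x y|x]; last by apply: cvg_pair => //; exact: cvg_cst.
by apply/pair_equal_spec; split; rewrite //= scaler0 addr0.
Qed.
Definition clin_inl : clin F (F * G)%type := Clin clin_inl_subproof.

Fact clin_inr_subproof : (fun y : G => (0 : F, y)) \in @clin_set R G (F * G)%type.
Proof.
rewrite inE; split=> [a x y|x]; last by apply: cvg_pair => //; exact: cvg_cst.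
by apply/pair_equal_spec; split; rewrite //= scaler0 addr0.
Qed.
Definition clin_inr : clin G (F * G)%type := Clin clin_inr_subproof.

Lemma Ck_pair n (U : set E) (f : E -> F) (g : E -> G) : open U ->
  Ck n U f -> Ck n U g -> Ck n U (fun x => (f x, g x)).
Proof.
move=> oU Cf Cg.
have -> : (fun x => (f x, g x)) = (fun x => (clin_inl \o f) x + (clin_inr \o g) x).
  by apply/funext => x /=; apply/pair_equal_spec; split; rewrite /= ?addr0 ?add0r.
by apply: CkD => //; exact: Ck_clin_comp.
Qed.

End pairs.

Lemma prod_cauchy_cvg (R : realType) (T U : completeNormedModType R)
    (F : set_system (T * U)) : ProperFilter F -> cauchy F -> exists l : T * U, F --> l.
Proof.
move=> PF /cauchyP CF.
have C1 : cauchy (fst @ F).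
  apply/cauchyP => e e0; have [[x y] Fxy] := CF e e0; exists x.
  by apply: (@filterS _ F _ _ _ _ Fxy) => -[z t]; rewrite /ball /= /prod_ball /= => -[].
have C2 : cauchy (snd @ F).
  apply/cauchyP => e e0; have [[x y] Fxy] := CF e e0; exists y.
  by apply: (@filterS _ F _ _ _ _ Fxy) => -[z t]; rewrite /ball /= /prod_ball /= => -[].
have fl : fst @ F --> lim (fst @ F) by exact: (@cauchy_cvg T _ _ C1).
have sm : snd @ F --> lim (snd @ F) by exact: (@cauchy_cvg U _ _ C2).
exists (lim (fst @ F), lim (snd @ F)).
apply: cvg_trans; last exact: (cvg_pair fl sm).
move=> A FA; have : F (fun x => A (x.1, x.2)) := FA.
by congr F; apply/funext => -[].
Qed.

(** * Corestriction of smooth maps to closed subspaces *)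

Definition norm_closed (R : realType) (G : normedModType R) (K : set G) :=
  forall x, (forall e, 0 < e -> exists2 y, K y & `|x - y| < e) -> K x.

Section Ck_corestrict.
Variable R : realType.
Implicit Types E F G : normedModType R.

(** An isometric [i] is injective, so the preimage of each [L x] is unique; it therefore depends
    linearly on [x], with the same bound. *)
Lemma clin_corestrict E F G (i : clin F G) : (forall x, `|i x| = `|x|) ->
  forall L : clin E G, (forall x, range i (L x)) ->
  exists M : clin E F, clin_comp i M = L.
Proof.
move=> ii L Li.
have inj : injective i.
  by move=> x y xy; apply/eqP; rewrite -subr_eq0 -normr_eq0 -ii linearB /= xy subrr normr0.
pose M x := sval (cid2 (Li x)).
have iM x : i (M x) = L x by rewrite /M; case: cid2.
have lM : linear M by move=> a x y; apply: inj; rewrite linearP /= !iM linearP.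
have MC x : `|M x| <= `|L| * `|x| by rewrite -ii iM; exact: clin_norm_bound.
by exists (mkclin lM MC); apply/val_inj/funext => x /=; rewrite iM.
Qed.

(** Difference quotients of [i \o f] lie in the range of [i], which is closed, so the derivative
    takes its values there and factors as [i] after some [D]. The induction then applies to [D]. *)
Lemma Ck_corestrict n E F G (U : set E) (f : E -> F) (i : clin F G) :
  (forall x, `|i x| = `|x|) -> norm_closed (range i) -> open U ->
  Ck n U (i \o f) -> Ck n U f.
Proof.
elim: n F G f i => [|n IH] F G f i ii iK oU Cif.
  move=> x Ux; apply/cvgrPdist_le => e e0.
  have /cvgrPdist_le/(_ e e0) := Cif x Ux.
  by apply: filterS => y; rewrite /= -linearB ii.
have H x : U x -> has_fderiv (i \o f) x (fderiv (i \o f) x) by exact: (CkS_has Cif).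
have Hr x : U x -> forall h, range i (fderiv (i \o f) x h).
  move=> Ux h; apply: iK => e e0.
  have [->|h0] := eqVneq h 0; first by exists 0; [exists 0; rewrite ?linear0|rewrite linear0 subrr normr0].
  have hgt : 0 < `|h| by rewrite normr_gt0.
  have e1 : 0 < e / 2 / `|h| by rewrite !divr_gt0.
  have [d /= d0 dH] := (nbhs_ballP _ _).1 (H x Ux _ e1).
  (* With this [t] the point [x + t *: h] is at distance [d / 2] from [x], hence in the ball where
     the error estimate holds. *)
  pose t := d / 2 / `|h|; have t0 : 0 < t by rewrite !divr_gt0.
  have bt : ball x d (x + t *: h).
    rewrite -ball_normE /= opprD addrA subrr sub0r normrN normrZ gtr0_norm//.
    by rewrite /t divfK ?gt_eqF// ltr_pdivrMr// ltr_pMr// ltr1n.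
  have := dH _ bt; rewrite /= [x + _]addrC addrK linearZ /= -linearB.
  set u := f _ - f x => Hu; exists (t^-1 *: i u); first by exists (t^-1 *: u); rewrite ?linearZ.
  have -> : fderiv (i \o f) x h - t^-1 *: i u = - (t^-1 *: (i u - t *: fderiv (i \o f) x h)).
    by rewrite scalerBr scalerA mulVf ?gt_eqF// scale1r opprB.
  rewrite normrN normrZ normfV (gtr0_norm t0) ltr_pdivrMl//.
  apply: le_lt_trans Hu _; rewrite normrZ (gtr0_norm t0) mulrCA -[_ * `|h|]mulrA mulVf ?gt_eqF//.
  by rewrite mulr1 ltr_pM2l// ltr_pdivrMr// ltr_pMr// ltr1n.
have [D iD] : exists D : E -> clin E F, forall x, U x -> clin_comp i (D x) = fderiv (i \o f) x.
  have ex x : exists M : clin E F, U x -> clin_comp i M = fderiv (i \o f) x.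
    have [Ux|nUx] := pselect (U x); last by exists 0.
    by have [M HM] := clin_corestrict ii (Hr x Ux); exists M.
  by exists (fun x => sval (cid (ex x))) => x Ux; case: cid => M /= ->.
apply: (@Ck_has_fderiv _ n _ _ _ _ D) => //.
  move=> x Ux e e0; apply: filterS (H x Ux e e0) => y.
  by rewrite -iD//= -!linearB ii.
(* Composition with [i] is itself an isometry between spaces of linear maps. Its range is closed: a
   limit of maps with values in the range of [i] has its values there too. *)
apply: (IH _ _ _ (bbil_left (bbil_comp E F G) i)) => //.
- move=> L; apply/le_anti/andP; split; apply: clin_norm_le => // x.
    by rewrite /= ii; exact: clin_norm_bound.
  rewrite -ii; exact: (clin_norm_bound (clin_comp i L)).
- move=> L HL.
  have [|M] := @clin_corestrict E F G i ii L; last by move=> <-; exists M.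
  move=> x; apply: iK => e e0.
  have e1 : 0 < e / (`|x| + 1) by rewrite divr_gt0// ltr_wpDl.
  have [_ [M _ <-] LM] := HL _ e1.
  exists (i (M x)); first by exists (M x).
  apply: le_lt_trans (clin_norm_bound (L - clin_comp i M) x) _.
  apply: (@le_lt_trans _ _ (e / (`|x| + 1) * `|x|)).
    by rewrite ler_wpM2r// ltW.
  by rewrite mulrAC ltr_pdivrMr ?ltr_wpDl// ltr_pM2l// ltrDl.
- by apply: Ck_eq oU _ Cif.2 => x Ux /=; rewrite iD.
Qed.

End Ck_corestrict.

(** * Subsets locally straightened onto closed subspaces *)

Section closed_submodule.
Variables (R : realType) (G : normedModType R).

(** Completeness of the ambient space is a field, not part of the type of [G], so that a product of
    two Banach spaces can be used with [prod_cauchy_cvg] as the proof. *)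
Record closed_submodule := ClosedSubmodule {
  csub_set : set G;
  csub_submod : submod_closed (mem csub_set);
  csub_closed : norm_closed csub_set;
  csub_complete : forall F : set_system G, ProperFilter F -> cauchy F ->
    exists l : G, F --> l }.

Variable K : closed_submodule.

Definition csub_pred : {pred G} := mem (csub_set K).

HB.instance Definition _ :=
  GRing.isSubmodClosed.Build _ _ csub_pred (csub_submod K).

Record csub := CSub { csub_val :> G; csub_valP : csub_val \in csub_pred }.

HB.instance Definition _ := [isSub for csub_val].
HB.instance Definition _ := [Choice of csub by <:].
HB.instance Definition _ := [SubChoice_isSubLmodule of csub by <:].

Definition csub_norm (x : csub) : R := `|csub_val x|.

Lemma csub_normD x y : csub_norm (x + y) <= csub_norm x + csub_norm y.
Proof. exact: ler_normD. Qed.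

Lemma csub_normZ a x : csub_norm (a *: x) = `|a| * csub_norm x.
Proof. exact: normrZ. Qed.

Lemma csub_norm0_eq0 x : csub_norm x = 0 -> x = 0.
Proof. by move=> x0; apply/val_inj; apply: normr0_eq0. Qed.

HB.instance Definition _ := Lmodule_isNormed.Build R csub
  csub_normD csub_normZ csub_norm0_eq0.

Lemma csub_cauchy_cvg (F : set_system csub) : ProperFilter F -> cauchy F -> cvg F.
Proof.
move=> PF /cauchyP CF.
have C : cauchy (csub_val @ F).
  apply/cauchyP => e e0; have [x Fx] := CF e e0; exists (csub_val x).
  by apply: filterS Fx => y; rewrite -!ball_normE => xy; exact: xy.
have [l Fl] := csub_complete K _ C.
have Kl : l \in csub_pred.
  apply/mem_set; apply: csub_closed => e e0.
  have ly : \forall y \near F, `|l - csub_val y| < e by exact: (cvgrPdist_lt _ _).1 Fl e e0.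
  have [y {}ly] := filter_ex ly.
  by exists (csub_val y) => //; exact/set_mem/csub_valP.
suff : F --> CSub Kl by move=> H; apply/cvg_ex; exists (CSub Kl).
apply/cvgrPdist_lt => e e0; exact: (cvgrPdist_lt _ _).1 Fl e e0.
Qed.

HB.instance Definition _ := Uniform_isComplete.Build csub csub_cauchy_cvg.

Fact csub_val_linear : linear (csub_val : csub -> G).
Proof. by []. Qed.

Fact csub_val_bound (x : csub) : `|csub_val x| <= 1 * `|x|.
Proof. by rewrite mul1r. Qed.

Definition csub_clin : clin csub G := mkclin csub_val_linear csub_val_bound.

Lemma csub_clin_closed : norm_closed (range csub_clin).
Proof.
move=> x Kx; suff Hx : x \in csub_pred by exists (CSub Hx).
apply/mem_set; apply: csub_closed => e /Kx[_ [y _ <-] xy].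
by exists (csub_val y) => //; exact/set_mem/csub_valP.
Qed.

End closed_submodule.

Section straightening.
Variables (R : realType) (G : normedModType R) (M : set G).

(* [st_map] and [st_inv] are smooth on open subsets of [G], but they are only
   required to be mutually inverse between [M] and [st_model]. *)
Record straightening := Straightening {
  st_model : closed_submodule G;
  st_dom : set G;
  st_cod : set G;
  st_map : G -> G;
  st_inv : G -> G;
  st_dom_open : open st_dom;
  st_cod_open : open st_cod;
  st_map_smooth : smooth st_dom st_map;
  st_inv_smooth : smooth st_cod st_inv;
  st_mapP : forall x, M x -> st_dom x ->
    [/\ st_cod (st_map x), csub_set st_model (st_map x) & st_inv (st_map x) = x];
  st_invP : forall y, csub_set st_model y -> st_cod y ->
    [/\ st_dom (st_inv y), M (st_inv y) & st_map (st_inv y) = y] }.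

Lemma set_val_in (x : set_type M) : M (set_val x).
Proof. exact: set_valP. Qed.


Section chart.
Variables (s : straightening) (m0 : set_type M).
Let N := csub (st_model s).

(** The default values [0] here and [m0] in the inverse only occur outside the domain and the
    codomain of the chart. *)
Definition st_chart_map (x : set_type M) : N := insubd (0 : N) (st_map s (set_val x)).
Definition st_chart_inv (y : N) : set_type M := insubd m0 (st_inv s (csub_val y)).
Definition st_chart_dom : set (set_type M) := set_val @^-1` st_dom s.
Definition st_chart_cod : set N := @csub_val _ _ _ @^-1` st_cod s.

Lemma st_chart_mapE x : st_chart_dom x ->
  csub_val (st_chart_map x) = st_map s (set_val x).
Proof.
move=> dx; have [_ Kx _] := st_mapP (set_val_in x) dx.
by rewrite -[LHS]/(val _) insubdK//; exact/mem_set.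
Qed.

Lemma st_chart_invE y : st_chart_cod y ->
  set_val (st_chart_inv y) = st_inv s (csub_val y).
Proof.
move=> cy; have [_ Mx _] := st_invP (set_mem (csub_valP y)) cy.
by rewrite -[LHS]/(val _) insubdK//; exact/mem_set.
Qed.

Lemma st_chart_dom_open : open st_chart_dom.
Proof.
apply: open_comp; last exact: st_dom_open.
by move=> x _; exact: initial_continuous.
Qed.

Lemma st_chart_cod_open : open st_chart_cod.
Proof.
apply: open_comp; last exact: st_cod_open.
by move=> x _; exact: (@clin_continuous _ _ _ (csub_clin _)).
Qed.

Lemma st_chart_map_fun : set_fun st_chart_dom st_chart_cod st_chart_map.
Proof.
move=> x dx; rewrite /st_chart_cod /= st_chart_mapE//.
by have [] := st_mapP (set_val_in x) dx.
Qed.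

Lemma st_chart_inv_fun : set_fun st_chart_cod st_chart_dom st_chart_inv.
Proof.
move=> y cy; rewrite /st_chart_dom /= st_chart_invE//.
by have [] := st_invP (set_mem (csub_valP y)) cy.
Qed.

Lemma st_chart_mapK x : st_chart_dom x -> st_chart_inv (st_chart_map x) = x.
Proof.
move=> dx; apply/val_inj; rewrite -[LHS]/(set_val _) st_chart_invE; last exact: st_chart_map_fun.
by rewrite st_chart_mapE//; have [] := st_mapP (set_val_in x) dx.
Qed.

Lemma st_chart_invK y : st_chart_cod y -> st_chart_map (st_chart_inv y) = y.
Proof.
move=> cy; apply/val_inj; rewrite -[LHS]/(csub_val _) st_chart_mapE; last exact: st_chart_inv_fun.
by rewrite st_chart_invE//; have [] := st_invP (set_mem (csub_valP y)) cy.
Qed.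

Lemma st_chart_map_continuous : {within st_chart_dom, continuous st_chart_map}.
Proof.
apply: continuous_in_subspaceT => x /set_mem dx.
have FF : Filter (nbhs x) := nbhs_filter x.
apply/(@cvgrPdist_lt _ _ _ _ (fmap_filter _ FF)) => e e0.
have cf : {for x, continuous (st_map s \o set_val)}.
  apply: continuous_comp; first exact: initial_continuous.
  exact: (@Ck_continuous _ 0%N _ _ _ _ (st_map_smooth s 0%N) _ dx).
have H1 : nbhs x st_chart_dom := open_nbhs_nbhs (conj st_chart_dom_open dx).
apply: (@filterS2 _ _ (nbhs_filter x) _ _ _ _ H1 ((cvgrPdist_lt _ _).1 cf e e0)) => y dy.
by rewrite /= -!st_chart_mapE.
Qed.

Lemma st_chart_inv_continuous : {within st_chart_cod, continuous st_chart_inv}.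
Proof.
apply: continuous_in_subspaceT => y /set_mem cy.
have cf : (st_inv s \o @csub_val _ _ _) @ y --> set_val (st_chart_inv y).
  rewrite st_chart_invE//.
  apply: (@continuous_comp _ _ _ (@csub_val _ _ _) (st_inv s) y).
    exact: (@clin_continuous _ _ _ (csub_clin _)).
  exact: (@Ck_continuous _ 0%N _ _ _ _ (st_inv_smooth s 0%N) _ cy).
move=> A [_ [[B oB <-] /= Bx] BA]; rewrite nbhs_simpl.
have := cf _ (open_nbhs_nbhs (conj oB Bx)).
apply: filterS2 (open_nbhs_nbhs (conj st_chart_cod_open cy)) => z cz Bz.
by apply: BA; rewrite /= st_chart_invE.
Qed.

Definition st_chart : chart R (set_type M) :=
  Chart st_chart_dom_open st_chart_cod_open st_chart_map_fun st_chart_inv_fun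
    st_chart_mapK st_chart_invK st_chart_map_continuous st_chart_inv_continuous.

End chart.

(** Followed by the inclusion of its model space, the transition is [st_map t \o st_inv s]
    restricted to a subspace, and thus smooth; [Ck_corestrict] removes the inclusion. *)
Lemma st_chart_transition (s t : straightening) (m n : set_type M) :
  smooth_transition (st_chart s m) (st_chart t n).
Proof.
move=> k; pose N := csub (st_model s).
pose V : set G := st_cod s `&` st_inv s @^-1` st_dom t.
have oV : open V.
  rewrite openE => y [cy dy].
  apply: filterS2 (open_nbhs_nbhs (conj (st_cod_open s) cy))
    (Ck_continuous (st_inv_smooth s 0%N) cy
      (open_nbhs_nbhs (conj (st_dom_open t) dy))) => z cz dz.
  by split.
pose W : set N := @csub_val _ _ _ @^-1` V.
have oW : open W.
  apply: open_comp => // y _; exact: (@clin_continuous _ _ _ (csub_clin _)).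
(* The image of the overlap is contained in the open set [W], so smoothness on [W] suffices. *)
apply: (@Ck_sub _ _ _ _ W).
  move=> _ [x [dx dx'] <-]; split; first exact: st_chart_map_fun.
  rewrite /= st_chart_mapE//.
  by have [_ _ ->] := st_mapP (set_val_in x) dx.
apply: (@Ck_corestrict _ _ _ _ _ _ _ (csub_clin (st_model t))) => //.
  exact: csub_clin_closed.
have C : Ck k W ((st_map t \o st_inv s) \o csub_clin (st_model s)).
  apply: (@Ck_comp _ _ _ _ _ _ V) => //; first exact: Ck_clin.
  apply: (@Ck_comp _ _ _ _ _ _ (st_dom t)) => //; first by move=> y [].
    by apply: Ck_sub (st_inv_smooth s k) => y [].
  exact: st_map_smooth.
apply: Ck_eq C => // y [cy dy] /=.
have Hd : st_chart_dom t (st_chart_inv m y) by rewrite /st_chart_dom /= st_chart_invE.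
by rewrite [RHS]st_chart_mapE// st_chart_invE.
Qed.

Lemma straightening_manifold :
  (forall m, M m -> exists s : straightening, st_dom s m) ->
  smooth_banach_manifold R (set_type M).
Proof.
move=> H; split.
  move=> x y xy; apply/val_inj; apply: (@norm_hausdorff _ G) => A B Ax By.
  have [z [Az Bz]] := xy _ _ (@initial_continuous _ _ (@set_val _ M) x A Ax)
    (@initial_continuous _ _ (@set_val _ M) y B By).
  by exists (set_val z).
(* The atlas has one chart for each point, and that point is also the default value of the inverse
   chart. *)
pose s (m : set_type M) := sval (cid (H _ (set_val_in m))).
exists (set_type M), (fun m => st_chart (s m) m); split.
  by move=> x; exists x; rewrite /= /s; case: cid.
by move=> i j; exact: st_chart_transition.
Qed.

End straightening.

(** * The Banach algebra of bounded operators *)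

Section bop_norm.
Variables (R : realType) (H : normedModType R[i]).

(** The norm of [H] takes values in [R[i]]; its real part brings estimates into the ordered field
    [R]. *)
Definition nrm (x : H) : R := complex.Re `|x|.

Lemma nrmE x : (nrm x)%:C = `|x|. Proof. exact: Re_normK. Qed.

Lemma nrm_ge0 x : 0 <= nrm x. Proof. rewrite -lecR nrmE; exact: (normr_ge0 x). Qed.

Lemma nrm0 : nrm 0 = 0. Proof. by apply: complexI; rewrite nrmE normr0. Qed.

Lemma nrmD x y : nrm (x + y) <= nrm x + nrm y.
Proof. by rewrite -lecR rmorphD /= !nrmE ler_normD. Qed.

Lemma nrmN x : nrm (- x) = nrm x. Proof. by apply: complexI; rewrite !nrmE normrN. Qed.

Lemma nrmB x y : nrm (x - y) = nrm (y - x). Proof. by rewrite -nrmN opprB. Qed.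

Lemma nrmZ (a : R[i]) x : nrm (a *: x) = complex.Re `|a| * nrm x.
Proof.
apply: complexI; rewrite rmorphM -[RHS]/((complex.Re `|a|)%:C * (nrm x)%:C) !nrmE.
by rewrite normrZ RRe_real// normr_real.
Qed.

Lemma nrmZR (a : R) x : nrm (a%:C *: x) = `|a| * nrm x.
Proof. by rewrite nrmZ normc_def /= expr0n addr0 sqrtr_sqr. Qed.

Lemma gt0_complexP (e : R[i]) : 0 < e -> exists2 d : R, 0 < d & e = d%:C.
Proof.
move=> e0; have e_real : e \is Num.real by rewrite gtr0_real.
by exists (complex.Re e); rewrite ?RRe_real// -ltcR RRe_real.
Qed.

Lemma nrm_bop (T : bop H) x : nrm (T x) <= `|T| * nrm x.
Proof.
have [->|x0] := eqVneq x 0; first by rewrite linear0 nrm0 mulr0.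
have nx0 : 0 < nrm x by rewrite -ltcR nrmE normr_gt0.
rewrite -ler_pdivrMr//.
have -> : nrm (T x) / nrm x = nrm (T ((nrm x)^-1%:C *: x)).
  by rewrite linearZ /= nrmZR normfV gtr0_norm// mulrC.
apply: (@sup_norm_ub _ _ _ nrm _ _ _ (bop_ub T)).
by rewrite /= -nrmE lecR nrmZR normfV gtr0_norm// mulVf// gt_eqF.
Qed.

Lemma bop_norm_le (T : bop H) C : 0 <= C ->
  (forall x, nrm (T x) <= C * nrm x) -> `|T| <= C.
Proof.
move=> C0 TC; apply: ge_sup.
  by have [x Bx] := bop_unit_ball0 H; exists (nrm (T x)), x.
move=> _ [x /= x1 <-]; apply: le_trans (TC x) _; rewrite ler_piMr//.
by rewrite -lecR nrmE.
Qed.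

Lemma nrm_bop_set (f : H -> H) (C : R) :
  linear f -> (forall x, nrm (f x) <= C * nrm x) -> f \in @bop_set R H.
Proof.
move=> lf fC; rewrite inE; split => //; exists C%:C => x.
by rewrite -!nrmE -rmorphM lecR.
Qed.

Definition mkbop (f : H -> H) (C : R) (lf : linear f)
  (fC : forall x, nrm (f x) <= C * nrm x) : bop H := Bop (nrm_bop_set lf fC).

Fact bop_one_subproof : (@id H) \in @bop_set R H.
Proof. by apply: (@nrm_bop_set _ 1) => // x; rewrite mul1r. Qed.
Definition bop_one : bop H := Bop bop_one_subproof.

Fact bop_mul_bound (S T : bop H) x : nrm (S (T x)) <= (`|S| * `|T|) * nrm x.
Proof.
by apply: le_trans (nrm_bop _ _) _; rewrite -mulrA ler_wpM2l// nrm_bop.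
Qed.

Fact bop_mul_subproof (S T : bop H) : S \o T \in @bop_set R H.
Proof.
apply: (nrm_bop_set _ (bop_mul_bound S T)) => a x y.
by rewrite /= !linearP.
Qed.
Definition bop_mul (S T : bop H) : bop H := Bop (bop_mul_subproof S T).

Fact bop_mulA : associative bop_mul. Proof. by move=> *; apply/val_inj. Qed.
Fact bop_mul1l : left_id bop_one bop_mul. Proof. by move=> *; apply/val_inj. Qed.
Fact bop_mul1r : right_id bop_one bop_mul. Proof. by move=> *; apply/val_inj. Qed.
Fact bop_mulDl : left_distributive bop_mul +%R. Proof. by move=> *; apply/val_inj. Qed.
Fact bop_mulDr : right_distributive bop_mul +%R.
Proof. by move=> S T U; apply/val_inj/funext => x; rewrite /= linearD. Qed.

HB.instance Definition _ := GRing.Zmodule_isPzRing.Build (bop H)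
  bop_mulA bop_mul1l bop_mul1r bop_mulDl bop_mulDr.

Lemma bop_normM (S T : bop H) : `|S * T| <= `|S| * `|T|.
Proof. by apply: bop_norm_le => [|x]; [rewrite mulr_ge0|exact: bop_mul_bound]. Qed.

Fact bop_mul_linearl (T : bop H) : linear (fun S : bop H => S * T).
Proof. by move=> a S U; apply/val_inj. Qed.

Fact bop_mul_linearr (S : bop H) : linear (fun T : bop H => S * T).
Proof. by move=> a T U; apply/val_inj/funext => x; rewrite /= linearP. Qed.

Fact bop_mul_bbil_bound (S T : bop H) : `|S * T| <= 1 * `|S| * `|T|.
Proof. by rewrite mul1r bop_normM. Qed.

Definition bop_bbil : bbil (bop H) (bop H) (bop H) :=
  Bbil bop_mul_linearl bop_mul_linearr bop_mul_bbil_bound.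

End bop_norm.

(** * Completeness of the space of bounded operators *)

Section bop_complete.
Variables (R : realType) (H : completeNormedModType R[i]).

(** A Cauchy filter of operators converges pointwise; the limit is linear, and the uniform estimates
    between members of the filter pass to it, which gives boundedness and convergence in norm. *)
Lemma bop_cauchy_cvg (F : set_system (bop H)) : ProperFilter F -> cauchy F -> cvg F.
Proof.
move=> PF /cauchyP CF.
have near_ball (T : bop H) e : F (ball T e) -> \forall S \near F, `|T - S| < e.
  by apply: filterS => S; rewrite -ball_normE.
have Fx x : (fun T : bop H => T x) @ F --> lim ((fun T : bop H => T x) @ F).
  apply: (@cauchy_cvg H); apply/cauchyP => e /gt0_complexP[d d0 ->].
  have d1 : 0 < d / (nrm x + 1) by rewrite divr_gt0// ltr_wpDl// nrm_ge0.
  have [T FT] := CF _ d1; exists (T x); apply: filterS (near_ball _ _ FT) => S TS.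
  rewrite -ball_normE /= -nrmE ltcR.
  apply: (le_lt_trans (nrm_bop (T - S) x)).
  apply: (@le_lt_trans _ _ (d / (nrm x + 1) * nrm x)).
    by rewrite ler_wpM2r ?nrm_ge0// ltW.
  rewrite mulrAC ltr_pdivrMr ?ltr_wpDl ?nrm_ge0// ltr_pM2l//.
  by rewrite ltrDl.
pose L x := lim ((fun T : bop H => T x) @ F).
have lL : linear L.
  move=> a x y; apply: (@cvg_unique _ (@norm_hausdorff _ H) _ _ _ _ (Fx (a *: x + y))).
  have -> : (fun T : bop H => T (a *: x + y)) = (fun T => a *: T x + T y).
    by apply/funext => T; rewrite linearP.
  by apply: cvgD; [apply: cvgZr; exact: Fx|exact: Fx].
have LT (T : bop H) e : F (ball T e) -> forall x, nrm (L x - T x) <= e * nrm x.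
  move=> FT x; apply/ler_addgt0Pr => d d0.
  have dC : (0 : R[i]) < d%:C by rewrite ltcR.
  have nF : F [set S : bop H | nrm (L x - S x) < d].
    have : F [set S : bop H | `|L x - S x| < d%:C].
      by apply: ((cvgrPdist_lt _ _).1 (Fx x) _ dC).
    by apply: filterS => S /=; rewrite -nrmE ltcR.
  have [S [TS LS]] := filter_ex (filterI (near_ball _ _ FT) nF).
  rewrite -[L x](subrK (S x)) -addrA addrC; apply: le_trans (nrmD _ _) _.
  apply: lerD; last exact: ltW.
  rewrite nrmB; apply: le_trans (nrm_bop (T - S) x) _.
  by rewrite ler_wpM2r ?nrm_ge0// ltW.
have [T1 FT1] := CF 1 ltr01.
have LC x : nrm (L x) <= (1 + `|T1|) * nrm x.
  rewrite -[L x](subrK (T1 x)) mulrDl; apply: le_trans (nrmD _ _) _.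
  by apply: lerD; [exact: LT|exact: nrm_bop].
suff : F --> mkbop lL LC by move=> FL; apply/cvg_ex; exists (mkbop lL LC).
apply/cvgrPdist_lt => e e0.
have e2 : 0 < e / 2 by rewrite divr_gt0.
have [T FT] := CF _ e2; apply: filterS (near_ball _ _ FT) => S TS.
rewrite -[_ - S](subrKA T) [e]splitr; apply: le_lt_trans (ler_normD _ _) _.
apply: ler_ltD; last exact: TS.
by apply: bop_norm_le; [exact: ltW|exact: LT].
Qed.

HB.instance Definition _ := Uniform_isComplete.Build (bop H) bop_cauchy_cvg.

End bop_complete.

(** * Invertible operators and smoothness of inversion *)

Section bop_unit.
Variables (R : realType) (H : completeNormedModType R[i]).
Implicit Types S T : bop H.

Definition bunit : set (bop H) := [set S | exists T, S * T = 1 /\ T * S = 1].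

Definition binv S : bop H := get [set T | S * T = 1 /\ T * S = 1].

Lemma mul_binv S : bunit S -> S * binv S = 1.
Proof. by move=> uS; have [] := getPex uS. Qed.

Lemma binv_mul S : bunit S -> binv S * S = 1.
Proof. by move=> uS; have [] := getPex uS. Qed.

Lemma bunitP S T : S * T = 1 -> T * S = 1 -> bunit S.
Proof. by move=> ST TS; exists T. Qed.

Lemma binvE S T : S * T = 1 -> T * S = 1 -> binv S = T.
Proof.
move=> ST TS; rewrite -[binv S]mulr1 -ST mulrA binv_mul ?mul1r//.
exact: bunitP ST TS.
Qed.

Lemma bunitM S T : bunit S -> bunit T -> bunit (S * T).
Proof.
move=> uS uT; apply: (@bunitP _ (binv T * binv S)).
  by rewrite mulrA -[S * T * _]mulrA mul_binv// mulr1 mul_binv.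
by rewrite mulrA -[binv T * _ * _]mulrA binv_mul// mulr1 binv_mul.
Qed.

Lemma bunitV S : bunit S -> bunit (binv S).
Proof. by move=> uS; exists S; rewrite binv_mul// mul_binv. Qed.

Lemma bunit1 : bunit 1. Proof. by exists 1; rewrite mulr1. Qed.

Lemma fixpoint_affine (f : bop H -> bop H) (q : R) : 0 <= q -> q < 1 ->
  (forall S T, `|f S - f T| <= q * `|S - T|) -> exists T, T = f T.
Proof.
move=> q0 q1 fq.
pose g : {fun [set: bop H] >-> [set: bop H]} := [fun of totalfun f].
have ctr : is_contraction g.
  exists (NngNum q0); split => //=.
  by move=> [S T] _ /=; exact: fq.
have ne : [set: bop H] !=set0 by exists 0.
by have [T _ HT] := banach_fixed_point ctr closedT ne; exists T.
Qed.

(** In place of the Neumann series: the contractions sending [U] to [1 + T * U] and [V] to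
    [1 + V * T] have fixed points, a right and a left inverse of [1 - T], and these coincide. *)
Lemma bunit_sub1 T : `|T| < 1 -> bunit (1 - T).
Proof.
move=> T1.
have [U HU] : exists U, U = 1 + T * U.
  apply: (@fixpoint_affine _ `|T|) => // S S'.
  by rewrite opprD addrACA subrr add0r -mulrBr bop_normM.
have [V HV] : exists V, V = 1 + V * T.
  apply: (@fixpoint_affine _ `|T|) => // S S'.
  by rewrite opprD addrACA subrr add0r -mulrBl mulrC bop_normM.
have rU : (1 - T) * U = 1 by rewrite mulrBl mul1r {1}HU addrK.
have lV : V * (1 - T) = 1 by rewrite mulrBr mulr1 {1}HV addrK.
have UV : U = V by rewrite -[LHS]mul1r -[X in X * _]lV -mulrA rU mulr1.
by exists U; rewrite rU UV lV.
Qed.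

Lemma bunit_near S T : bunit S -> `|T - S| * `|binv S| < 1 -> bunit T.
Proof.
move=> uS TS.
have -> : T = S * (1 - binv S * (S - T)).
  by rewrite mulrBr mulr1 mulrA mul_binv// mul1r opprB addrC subrK.
apply: bunitM => //; apply: bunit_sub1; apply: le_lt_trans TS.
by rewrite distrC mulrC bop_normM.
Qed.

Lemma bunit_open : open bunit.
Proof.
rewrite openE => S uS.
have d0 : 0 < (`|binv S| + 1)^-1 by rewrite invr_gt0 ltr_wpDl.
apply/nbhs_ballP; exists ((`|binv S| + 1)^-1) => //= T.
rewrite -ball_normE /= distrC => ST; apply: (bunit_near uS).
have [->|nz] := eqVneq `|binv S| 0; first by rewrite mulr0.
apply: (@lt_le_trans _ _ ((`|binv S| + 1)^-1 * `|binv S|)).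
  by rewrite ltr_pM2r// lt_def nz /=.
by rewrite mulrC ler_pdivrMr ?ltr_wpDl// mul1r lerDl.
Qed.

Definition binv_deriv S : clin (bop H) (bop H) :=
  bbil_comp _ _ _ (bbil_left (bop_bbil H) (- binv S)) (bbil_right (bop_bbil H) (binv S)).

(** Using the resolvent identity [ST1] twice, the remainder becomes [binv T * (S - T) * binv S * (S
    - T) * binv S], which is quadratic in [T - S] once [binv T] is bounded near [S]. *)
Lemma binv_has_fderiv S : bunit S -> has_fderiv binv S (binv_deriv S).
Proof.
move=> uS e e0.
pose b := `|binv S| + 1; have b0 : 0 < b by rewrite ltr_wpDl.
have bb : `|binv S| <= b by rewrite lerDl.
(* The first radius ensures that [T] is invertible with [binv T] of norm at most [2 b]; the second
   makes the product of the bounds [2 b], [e / (2 b^3)], [b] and [b] equal to [e]. *)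
have d1 : 0 < (b *+ 2)^-1 by rewrite invr_gt0 mulrn_wgt0.
have d2 : 0 < e / (b ^+ 3 *+ 2) by rewrite divr_gt0// mulrn_wgt0// exprn_gt0.
have nid : @id (bop H) @ S --> S by exact: cvg_id.
near=> T.
have n1 : `|T - S| <= (b *+ 2)^-1.
  by rewrite distrC; near: T; exact: (cvgrPdist_le _ _).1 nid _ d1.
have n2 : `|T - S| <= e / (b ^+ 3 *+ 2).
  by rewrite distrC; near: T; exact: (cvgrPdist_le _ _).1 nid _ d2.
have TS2 : `|T - S| * `|binv S| <= 2^-1.
  have <- : (b *+ 2)^-1 * b = 2^-1 by field; rewrite gt_eqF.
  exact: ler_pM.
have uT : bunit T.
  by apply: (bunit_near uS); apply: le_lt_trans TS2 _; rewrite invf_lt1// ltr1n.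
have ST1 : binv T - binv S = binv T * (S - T) * binv S.
  by rewrite mulrBr binv_mul// mulrBl mul1r -mulrA mul_binv// mulr1.
have Tb : `|binv T| <= b *+ 2.
  (* The unknown norm of [binv T] occurs on both sides, on the right with factor one half, and can
     be absorbed. *)
  have : `|binv T| <= `|binv S| + `|binv T| * 2^-1.
    rewrite -{1}[binv T](subrK (binv S)) addrC.
    apply: le_trans (ler_normD _ _) _; rewrite lerD2l ST1 -mulrA.
    apply: le_trans (bop_normM _ _) _; rewrite ler_wpM2l//.
    by apply: le_trans (bop_normM _ _) _; rewrite distrC.
  rewrite -lerBlDr -{1}[`|binv T|]mulr1 -mulrBr => Hb.
  have -> : `|binv T| = (`|binv T| * (1 - 2^-1)) *+ 2.
    by field.
  by rewrite lerMn2r/=; exact: le_trans Hb bb.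
have -> : binv T - binv S - binv_deriv S (T - S) =
    binv T * (S - T) * binv S * (S - T) * binv S.
  rewrite -[binv_deriv S _]/(- binv S * ((T - S) * binv S)).
  rewrite mulNr opprK -ST1 -[T - S]opprB mulNr mulrN ST1 -!mulrA -mulrBl ST1.
  by rewrite !mulrA.
apply: le_trans (bop_normM _ _) _; apply: le_trans (ler_wpM2r _ (bop_normM _ _)) _ => //.
apply: (@le_trans _ _ ((b *+ 2 * (e / (b ^+ 3 *+ 2)) * b * `|T - S|) * b)).
  apply: ler_pM => //.
  rewrite [`|S - T|]distrC ler_wpM2r//.
  apply: le_trans (bop_normM _ _) _; apply: ler_pM => //.
  apply: le_trans (bop_normM _ _) _; apply: ler_pM => //.
rewrite -mulrA [_ * b as X in _ * X]mulrC mulrA ler_wpM2r//.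
have bn : b != 0 by rewrite gt_eqF.
rewrite le_eqVlt; apply/orP; left; apply/eqP.
by field.
Unshelve. all: by end_near. Qed.

End bop_unit.

Section bbil_curry.
Variables (R : realType) (E F G : normedModType R) (B : bbil E F G).

Fact bbil_left_linear : linear (bbil_left B).
Proof. by move=> a x y; apply/val_inj/funext => z /=; rewrite bbil_linearl. Qed.

Fact bbil_left_bound x : `|bbil_left B x| <= bbil_pos B * `|x|.
Proof.
apply: clin_norm_le; first by rewrite mulr_ge0// bbil_pos_ge0.
by move=> y; exact: bbil_bound_pos.
Qed.

(** Makes the operator of left multiplication depend linearly on its factor, so that [binv_deriv S]
    is seen to be a bilinear expression in [binv S]. *)
Definition bbil_curry : clin E (clin F G) := mkclin bbil_left_linear bbil_left_bound.

Fact bbil_right_linear : linear (bbil_right B).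
Proof. by move=> a x y; apply/val_inj/funext => z /=; rewrite bbil_linearr. Qed.

Fact bbil_right_norm y : `|bbil_right B y| <= bbil_pos B * `|y|.
Proof.
apply: clin_norm_le; first by rewrite mulr_ge0// bbil_pos_ge0.
by move=> x; rewrite mulrAC; exact: bbil_bound_pos.
Qed.

Definition bbil_curry_flip : clin F (clin E G) := mkclin bbil_right_linear bbil_right_norm.

End bbil_curry.

Section clin_opp.
Variables (R : realType) (E : normedModType R).

Fact oppr_linear : linear (-%R : E -> E).
Proof. by move=> a x y; rewrite opprD scalerN. Qed.

Fact oppr_bound (x : E) : `|- x| <= 1 * `|x|.
Proof. by rewrite normrN mul1r. Qed.

Definition clin_opp : clin E E := mkclin oppr_linear oppr_bound.

End clin_opp.

(** * Smoothness of sums, products and inverses *)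

Section smooth_maps.
Variables (R : realType) (X : normedModType R) (U : set X).
Hypothesis oU : open U.
Implicit Types E F G : normedModType R.

Lemma smooth_cst E (c : E) : smooth U (fun=> c).
Proof. by move=> n; exact: Ck_cst. Qed.

Lemma smooth_clin E (L : clin X E) : smooth U L.
Proof. by move=> n; exact: Ck_clin. Qed.

Lemma smoothD E (f g : X -> E) : smooth U f -> smooth U g ->
  smooth U (fun x => f x + g x).
Proof. by move=> sf sg n; apply: CkD. Qed.

Lemma smoothN E (f : X -> E) : smooth U f -> smooth U (fun x => - f x).
Proof. by move=> sf n; apply: (Ck_clin_comp (clin_opp E)). Qed.

Lemma smoothB E (f g : X -> E) : smooth U f -> smooth U g ->
  smooth U (fun x => f x - g x).
Proof. by move=> sf sg; apply: smoothD => //; exact: smoothN. Qed.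

Lemma smooth_pair E F (f : X -> E) (g : X -> F) : smooth U f -> smooth U g ->
  smooth U (fun x => (f x, g x)).
Proof. by move=> sf sg n; apply: Ck_pair. Qed.

Lemma smooth_preimage_open E (f : X -> E) (W : set E) :
  smooth U f -> open W -> open (U `&` f @^-1` W).
Proof.
move=> sf oW; rewrite openE => x [Ux Wx].
apply: filterS2 (open_nbhs_nbhs (conj oU Ux))
  (Ck_continuous (sf 0%N) Ux (open_nbhs_nbhs (conj oW Wx))) => y Uy Wy.
by split.
Qed.

Lemma smooth_sub E (V : set X) (f : X -> E) : V `<=` U -> smooth U f -> smooth V f.
Proof. by move=> VU sf n; exact: Ck_sub (sf n). Qed.

Variable H : completeNormedModType R[i].

Lemma smoothM (f g : X -> bop H) : smooth U f -> smooth U g ->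
  smooth U (fun x => f x * g x).
Proof. by move=> sf sg n; apply: (Ck_bbil (bop_bbil H)). Qed.

(** Bootstrapping: the derivative of [binv] is bilinear in [binv] itself, so class [n] of [binv]
    gives class [n] of the derivative. *)
Lemma Ck_binv n : Ck n (@bunit R H) (@binv R H).
Proof.
elim: n => [|n IH].
  move=> S uS; have [dS _] := has_fderivP (binv_has_fderiv uS).
  exact: differentiable_continuous.
apply: (Ck_has_fderiv (@bunit_open R H) (@binv_has_fderiv R H)).
apply: (Ck_bbil (bbil_comp _ _ _) (bunit_open (H := H))
  (f := bbil_curry (bop_bbil H) \o (-%R \o @binv R H))
  (g := bbil_curry_flip (bop_bbil H) \o @binv R H)).
  apply: Ck_clin_comp; first exact: bunit_open.
  by apply: (Ck_clin_comp (clin_opp _)); [exact: bunit_open|].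
by apply: Ck_clin_comp; [exact: bunit_open|].
Qed.

Lemma smooth_binv (f : X -> bop H) : (forall x, U x -> bunit (f x)) ->
  smooth U f -> smooth U (fun x => binv (f x)).
Proof. by move=> fu sf n; apply: (Ck_comp oU fu) => //; exact: Ck_binv. Qed.

End smooth_maps.

(** * Compact operators and adjoints *)

Section compact_operators.
Variables (R : realType) (H : completeNormedModType R[i]).

Definition totally_bounded (A : set H) := forall e : R, 0 < e ->
  exists s : seq H, forall x, A x -> exists2 y, y \in s & nrm (x - y) < e.

Lemma ball_nrm (x y : H) (e : R) : ball x e%:C y <-> nrm (x - y) < e.
Proof. by rewrite -ball_normE /= -nrmE ltcR. Qed.

Lemma ultra_seq (F : set_system H) (f : H -> set H) (s : seq H) : UltraFilter F ->
  F [set x | exists2 y, y \in s & f y x] -> exists2 y, y \in s & F (f y).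
Proof.
move=> UF; elim: s => [|y s IH] Fs.
  by have [x [y]] := filter_ex Fs; rewrite in_nil.
have [Fy|nFy] := in_ultra_setVsetC (f y) UF; first by exists y; rewrite ?mem_head.
have [|z zs Fz] := IH; last by exists z; rewrite ?in_cons ?zs ?orbT.
apply: filterS (filterI Fs nFy) => x [[z]].
by rewrite in_cons => /predU1P[->//|zs fz _]; exists z.
Qed.

(** From left to right, a finite subcover of the closure by balls. Conversely, an ultrafilter on the
    closure contains one of finitely many balls of each radius, hence is Cauchy and converges. *)
Lemma precompactP (A : set H) : precompact A <-> totally_bounded A.
Proof.
rewrite precompactE; split.
  rewrite compact_cover => cA e e0.
  have eC : (0 : R[i]) < e%:C by rewrite ltcR.
  have [||D _ AD] := cA H (closure A) (fun y => ball y e%:C).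
  - by move=> y _; exact: ball_open.
  - by move=> x Ax; exists x => //; exact: ballxx.
  exists (finmap.enum_fset D) => x /(@subset_closure _ A)/AD[y /= yD /ball_nrm].
  by rewrite nrmB => yx; exists y.
move=> tA; rewrite compact_ultra => F UF FA.
have CF : cauchy F.
  apply/cauchyP => _ /gt0_complexP[e e0 ->].
  have e2 : 0 < e / 2 by rewrite divr_gt0.
  have e2C : (0 : R[i]) < (e / 2)%:C by rewrite ltcR.
  have [s As] := tA _ e2.
  suff [y _ Fy] : exists2 y, y \in s & F (ball y e%:C) by exists y.
  apply: (@ultra_seq F (fun y => ball y e%:C)).
  apply: filterS FA => x /(_ _ (nbhsx_ballx x _ e2C))[z [/As[y ys zy] /ball_nrm xz]].
  exists y => //; apply/ball_nrm; rewrite nrmB -(subrK z x) -addrA [e]splitr.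
  by apply: le_lt_trans (nrmD _ _) _; exact: ltrD.
have Fl : F --> lim F by exact: (@cauchy_cvg H).
exists (lim F); split => //.
apply: (@closed_closure _ A) => B /Fl FB.
by have [x [Ax Bx]] := filter_ex (filterI FA FB); exists x.
Qed.

Definition kop (T : bop H) := compact_operator T.

Lemma kopP (T : bop H) : kop T <-> forall e : R, 0 < e ->
  exists s : seq H, forall x, nrm x <= 1 -> exists2 y, y \in s & nrm (T x - y) < e.
Proof.
rewrite /kop /compact_operator precompactP; split => H0 e /H0[s Hs]; exists s.
  by move=> x x1; apply: Hs; exists x => //=; rewrite -nrmE lecR.
by move=> _ [x /= + <-]; rewrite -nrmE lecR => /Hs.
Qed.

Lemma kopD S T : kop S -> kop T -> kop (S + T).
Proof.
move=> /kopP kS /kopP kT; apply/kopP => e e0.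
have e2 : 0 < e / 2 by rewrite divr_gt0.
have [s Ss] := kS _ e2; have [t Tt] := kT _ e2.
exists [seq y + z | y <- s, z <- t] => x x1.
have [y ys Sy] := Ss _ x1; have [z zt Tz] := Tt _ x1.
exists (y + z); first by apply/allpairsP; exists (y, z).
rewrite -[(S + T) x]/(S x + T x) opprD addrACA [e]splitr.
by apply: le_lt_trans (nrmD _ _) _; exact: ltrD.
Qed.

Lemma kop0 : kop 0.
Proof. by apply/kopP => e e0; exists [:: 0] => x _; exists 0; rewrite ?mem_head// subrr nrm0. Qed.

Lemma kopMl S K : kop K -> kop (S * K).
Proof.
move=> /kopP kK; apply/kopP => e e0.
have S0 : 0 < `|S| + 1 by rewrite ltr_wpDl.
have [s Ks] := kK _ (divr_gt0 e0 S0).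
exists (map S s) => x /Ks[y ys Ky]; exists (S y); first exact: map_f.
rewrite -[(S * K) x]/(S (K x)) -linearB.
apply: le_lt_trans (nrm_bop _ _) _.
apply: (@le_lt_trans _ _ ((`|S| + 1) * nrm (K x - y))).
  by rewrite ler_wpM2r ?nrm_ge0// lerDl.
by rewrite mulrC -ltr_pdivlMr.
Qed.

Lemma kopMr K S : kop K -> kop (K * S).
Proof.
move=> /kopP kK; apply/kopP => e e0.
have S0 : 0 < `|S| + 1 by rewrite ltr_wpDl.
pose c := `|S| + 1.
have [s Ks] := kK _ (divr_gt0 e0 S0).
exists [seq c%:C *: y | y <- s] => x x1.
have [|y ys Ky] := Ks (c^-1%:C *: S x).
  rewrite nrmZR normfV gtr0_norm// ler_pdivrMl// mulr1.
  apply: le_trans (nrm_bop _ _) _; rewrite (le_trans (ler_piMr _ x1))//.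
  by rewrite lerDl.
exists (c%:C *: y); first exact: map_f.
have -> : (K * S) x = c%:C *: K (c^-1%:C *: S x).
  by rewrite linearZ /= scalerA -rmorphM divff ?gt_eqF// scale1r.
by rewrite -scalerBr nrmZR gtr0_norm// mulrC -ltr_pdivlMr.
Qed.

Lemma kopN K : kop K -> kop (- K).
Proof. by move=> kK; rewrite -mulN1r; exact: kopMl. Qed.

Lemma kopZ (a : R) K : kop K -> kop (a *: K).
Proof.
move=> kK; have -> : a *: K = (a *: (1 : bop H) : bop H) * K by apply/val_inj/funext.
exact: kopMl.
Qed.

Lemma kop_closed : norm_closed [set T : bop H | kop T].
Proof.
move=> T HT; apply/kopP => e e0.
have e2 : 0 < e / 2 by rewrite divr_gt0.
have [K /kopP/(_ _ e2)[s Ks] TK] := HT _ e2.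
exists s => x x1; have [y ys Ky] := Ks _ x1; exists y => //.
rewrite -(subrK (K x) (T x)) -addrA [e]splitr.
apply: le_lt_trans (nrmD _ _) _; apply: ler_ltD => //.
apply: le_trans (nrm_bop (T - K) x) _; apply: le_trans (ler_piMr _ x1) _ => //.
exact: ltW.
Qed.

End compact_operators.

(** * Adjoint pairs of operators *)

Section adjoint.
Variables (R : realType) (H : completeNormedModType R[i]).
Variables (dot : {dot H for Num.conj}) (dot_norm : forall x : H, dot x x = `|x| ^+ 2).

(** A relation between two operators: the adjoints that occur below are all given by explicit
    formulas. *)
Definition adjoint (S T : bop H) := forall x y, dot (S x) y = dot x (T y).

Lemma adjoint_sym S T : adjoint S T -> adjoint T S.
Proof.
by move=> ST x y; rewrite [LHS]hermC [RHS]hermC; congr (_ * Num.conj _); exact: esym (ST y x).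
Qed.

Lemma adjoint1 : adjoint 1 1. Proof. by []. Qed.

Lemma adjoint0 : adjoint 0 0. Proof. by move=> x y; rewrite linear0l linear0r. Qed.

Lemma adjointD S S' T T' : adjoint S S' -> adjoint T T' -> adjoint (S + T) (S' + T').
Proof.
move=> SS' TT' x y.
rewrite -[(S + T) x]/(S x + T x) -[(S' + T') y]/(S' y + T' y).
by rewrite linearDl linearDr; congr (_ + _); [exact: SS'|exact: TT'].
Qed.

Lemma adjointN S S' : adjoint S S' -> adjoint (- S) (- S').
Proof.
move=> SS' x y; rewrite -[(- S) x]/(- S x) -[(- S') y]/(- S' y).
by rewrite linearNl linearNr; congr (- _); exact: SS'.
Qed.

Lemma adjointB S S' T T' : adjoint S S' -> adjoint T T' -> adjoint (S - T) (S' - T').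
Proof. by move=> SS' TT'; apply: adjointD => //; exact: adjointN. Qed.

Lemma adjointM S S' T T' : adjoint S S' -> adjoint T T' -> adjoint (S * T) (T' * S').
Proof.
move=> SS' TT' x y.
by rewrite -[(S * T) x]/(S (T x)) -[(T' * S') y]/(T' (S' y)) SS' TT'.
Qed.

Lemma adjointV S S' : adjoint S S' -> bunit S -> bunit S' -> adjoint (binv S) (binv S').
Proof.
move=> SS' uS uS' x y.
rewrite -[y in LHS]/((1 : bop H) y) -(mul_binv uS') -[(S' * _) y]/(S' (binv S' y)).
by rewrite -SS' -[S (binv S x)]/((S * binv S) x) mul_binv.
Qed.

Lemma adjointZ (a : R) S S' : adjoint S S' -> adjoint (a *: S) (a *: S').
Proof.
move=> SS' x y; rewrite -[(a *: S) x]/(a%:C *: S x) -[(a *: S') y]/(a%:C *: S' y).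
by rewrite linearZl_LR linearZr_LR /= SS' conj_Creal// complex_real.
Qed.

(** Positivity of [dot] at [b *: x - a *: y], with [a = dot x y] and [b = dot y y], expands to [b]
    times the wanted difference. *)
Lemma dot_CauchySchwarz x y : `|dot x y| <= `|x| * `|y|.
Proof.
have [->|y0] := eqVneq y 0; first by rewrite linear0r !normr0 mulr0.
have b0 : 0 < dot y y by rewrite dnorm_gt0.
pose a := dot x y; pose b := dot y y.
have H0 : 0 <= b * (b * dot x x - `|a| ^+ 2).
  suff -> : b * (b * dot x x - `|a| ^+ 2) = dot (b *: x - a *: y) (b *: x - a *: y).
    exact: dnorm_ge0.
  rewrite dnormB !dnormZ linearZl_LR linearZr_LR /= -/a -/b.
  rewrite (gtr0_norm b0) rmorphM rmorphM /= conjCK (conj_Creal (gtr0_real b0)).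
  have -> : `|a| ^+ 2 = a * a^* by rewrite normCK.
  by ring.
have : `|a| ^+ 2 <= (`|x| * `|y|) ^+ 2.
  rewrite exprMn -!dot_norm -subr_ge0 mulrC.
  by rewrite -(pmulr_rge0 _ b0).
by rewrite ler_pXn2r// nnegrE// mulr_ge0.
Qed.

(** The defect [z] of self-adjointness at [x] and [y] is bounded by a multiple of the distance from
    [S] to any self-adjoint [T], hence vanishes. *)
Lemma adjoint_closed : norm_closed [set S : bop H | adjoint S S].
Proof.
move=> S HS x y; apply/eqP; rewrite -subr_eq0; apply/eqP.
set z := dot _ _ - _.
have zE (T : bop H) : adjoint T T -> `|z| <= (2 * `|S - T| * (nrm x * nrm y))%:C.
  move=> TT.
  have -> : z = dot ((S - T) x) y - dot x ((S - T) y).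
    rewrite -[(S - T) x]/(S x - T x) -[(S - T) y]/(S y - T y).
    have K (p q r t : R[i]) : q = t -> p - q - (r - t) = p - r by move=> ->; ring.
    by rewrite linearBl linearBr; apply/esym/K; exact: TT.
  apply: le_trans (ler_normB _ _) _.
  apply: le_trans (lerD (dot_CauchySchwarz _ _) (dot_CauchySchwarz _ _)) _.
  rewrite -!nrmE -!rmorphM -rmorphD lecR.
  rewrite -mulrA mulr_natl mulr2n; apply: lerD.
    by rewrite mulrA ler_wpM2r ?nrm_ge0// nrm_bop.
  by rewrite mulrCA ler_wpM2l ?nrm_ge0// nrm_bop.
apply/eqP; apply/negPn/negP => z0.
have [r r0 zr] : exists2 r : R, 0 < r & `|z| = r%:C.
  by apply: gt0_complexP; rewrite normr_gt0.
(* The added 1 makes [c] positive even for zero vectors, and gives the strict inequality in the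
   contradiction [r < r]. *)
pose c := 2 * (nrm x * nrm y) + 1.
have c0 : 0 < c by rewrite ltr_wpDl// !mulr_ge0// nrm_ge0.
have [T TT ST] := HS _ (divr_gt0 r0 c0).
have := zE _ TT; rewrite zr lecR => rc.
suff : r < r by rewrite ltxx.
apply: le_lt_trans rc _; rewrite mulrAC.
apply: (@le_lt_trans _ _ (2 * (nrm x * nrm y) * (r / c))).
  by apply: ler_wpM2l; [rewrite !mulr_ge0// nrm_ge0|exact: ltW].
rewrite mulrCA gtr_pMr// ltr_pdivrMr// mul1r.
by rewrite ltrDl.
Qed.

End adjoint.

(** * Algebra of the chart *)

Section reflection.
Variable A : pzRingType.
Implicit Types p q : A.

(** For an idempotent [p], the symmetry that is 1 on the range and -1 on the kernel. *)
Definition refl p : A := p + p - 1.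

Lemma mul_refl p : p * p = p -> p * refl p = p.
Proof. by move=> pp; rewrite mulrBr mulrDr pp mulr1 addrK. Qed.

Lemma refl_mul p : p * p = p -> refl p * p = p.
Proof. by move=> pp; rewrite mulrBl mulrDl pp mul1r addrK. Qed.

Lemma reflK p : p * p = p -> refl p * refl p = 1.
Proof.
move=> pp; rewrite {1}/refl mulrBl mulrDl (mul_refl pp) mul1r.
by rewrite opprB addrC subrK.
Qed.

(* The next four identities say that [q + p - 1] intertwines [p] and [q]. *)
Lemma mid_mull p q : q * q = q -> q * (q + p - 1) = q * p.
Proof. by move=> qq; rewrite mulrBr mulrDr qq mulr1 addrC addKr. Qed.

Lemma mid_mulr p q : p * p = p -> (q + p - 1) * p = q * p.
Proof. by move=> pp; rewrite mulrBl mulrDl pp mul1r addrK. Qed.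

Lemma midl_mul p q : p * p = p -> p * (q + p - 1) = p * q.
Proof. by move=> pp; rewrite mulrBr mulrDr pp mulr1 addrK. Qed.

Lemma midr_mul p q : q * q = q -> (q + p - 1) * q = p * q.
Proof. by move=> qq; rewrite mulrBl mulrDl qq mul1r addrC addKr. Qed.

End reflection.

(** * From a projection to its graph coordinate *)

Section forward.
Variables (A : pzRingType) (p q ai : A).
Hypotheses (pp : p * p = p) (qq : q * q = q).
Hypotheses (aai : (q + p - 1) * ai = 1) (aia : ai * (q + p - 1) = 1).
Let S := (q - p) * ai * refl p.

Lemma inv_mid_mul : ai * p = q * ai.
Proof.
rewrite -[LHS]mulr1 -aai mulrA -[ai * p * _]mulrA (midl_mul _ pp).
by rewrite -(midr_mul _ qq) mulrA aia mul1r.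
Qed.

Lemma graph_refl : S * refl p = (q - p) * ai.
Proof. by rewrite /S -mulrA (reflK pp) mulr1. Qed.

(** Since [q + p - 1] and [q - p] add up to [refl q]. The shift is thus invertible as a product of
    invertible factors. *)
Lemma graph_shift : 1 + S * refl p = refl q * ai.
Proof.
rewrite graph_refl -{1}aai -mulrDl; congr (_ * _).
by rewrite addrAC addrACA subrr addr0.
Qed.

Lemma graph_shift_mul : (1 + S * refl p) * p = q * (1 + S * refl p).
Proof.
by rewrite graph_shift -mulrA inv_mid_mul mulrA (refl_mul qq) mulrA (mul_refl qq).
Qed.

Lemma graphE : S = (q - p) * refl q * ai.
Proof.
rewrite /S -!mulrA; congr (_ * _).
by rewrite /refl mulrBr mulrBl mulrDr mulrDl inv_mid_mul mulr1 mul1r.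
Qed.

Lemma diff_refl : (q - p) * refl q = q - (p * q + p * q - p).
Proof. by rewrite mulrBl (mul_refl qq) mulrBr mulrDr mulr1. Qed.

Lemma graph_codiag : p * S + S * p = S.
Proof.
have -> : S * p = (q - p) * q * ai.
  by rewrite /S -!mulrA (refl_mul pp) inv_mid_mul.
rewrite graphE !mulrA -mulrDl; congr (_ * _).
rewrite -mulrA diff_refl mulrBl qq mulrBr mulrBr mulrDr !mulrA pp.
by rewrite addrC subrKA.
Qed.

(** The left-hand side is the adjoint of [S] when [p] and [q] are self-adjoint. The reason for
    equality is that [q - p] anticommutes with [q + p - 1]. *)
Lemma graph_adjoint : refl p * ai * (q - p) = S.
Proof.
have aD : (q + p - 1) * (q - p) = - ((q - p) * (q + p - 1)).
  rewrite mulrBr (midr_mul _ qq) (mid_mulr _ pp).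
  by rewrite mulrBl (mid_mull _ qq) (midl_mul _ pp) opprB.
have -> : refl p * ai * (q - p) = - (refl p * (q - p) * ai).
  rewrite -!mulrA -mulrN; congr (_ * _).
  rewrite -[LHS]mulr1 -aai -!mulrA [(q - p) * (_ * _)]mulrA -[_ * (q + p - 1)]opprK.
  by rewrite -aD mulNr mulrN !mulrA aia mul1r.
rewrite graphE -mulNr; congr (_ * _); rewrite diff_refl.
rewrite mulrBr (refl_mul pp) mulrBl mulrDl mul1r opprB opprB addrCA.
by rewrite opprB.
Qed.

End forward.

(** * From a graph coordinate to its projection *)

Section backward.
Variables (A : pzRingType) (p S gi : A).
Hypotheses (pp : p * p = p) (cS : p * S + S * p = S).
Let e := refl p.
Let g := 1 + S * e.
Hypotheses (ggi : g * gi = 1) (gig : gi * g = 1).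
Let q := g * p * gi.

Lemma codiag_diag : p * S * p = 0.
Proof.
have := congr1 (fun x => p * x) cS; rewrite mulrDr !mulrA pp => /eqP.
by rewrite -subr_eq0 addrC addKr => /eqP.
Qed.

Lemma codiagE : S * e = S * p - p * S.
Proof. by rewrite mulrBr mulrDr mulr1 -{3}cS opprD [- (p * S) - _]addrC addrA addrK. Qed.

(** [S] exchanges the range and the kernel of [p], on which [e] has opposite signs. *)
Lemma codiag_refl : e * S = - (S * e).
Proof. by rewrite codiagE opprB mulrBl mulrDl mul1r -{3}cS opprD addrA addrK. Qed.

Lemma codiag_sqr : p * (S * S) = S * S * p.
Proof.
have pS : p * S = S - S * p by rewrite -{2}cS addrK.
by rewrite mulrA pS mulrBl -(mulrA S p) pS mulrBr opprB addrC subrK mulrA.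
Qed.

Lemma shift_mul : g * p = p + S * p.
Proof. by rewrite mulrDl mul1r -mulrA (refl_mul pp). Qed.

Lemma mul_shift : p * g = p - p * S.
Proof.
rewrite mulrDr mulr1 codiagE mulrBr !mulrA codiag_diag pp.
by rewrite sub0r.
Qed.

Lemma graph_idem : q * q = q.
Proof.
by rewrite /q -!mulrA [gi * _]mulrA gig mul1r [p * (p * _)]mulrA pp.
Qed.

(** After multiplication by [g] on the right the claim is [g * p + p * g - g = e], where the terms
    in [S] cancel. *)
Lemma graph_mid : q + p - 1 = e * gi.
Proof.
rewrite -[LHS]mulr1 -[X in _ * X]ggi [LHS]mulrA; congr (_ * _).
rewrite mulrBl mulrDl mul1r {1}/q -mulrA gig mulr1 shift_mul mul_shift.
by rewrite addrACA /g codiagE opprD [LHS]addrACA subrr addr0.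
Qed.

Lemma graph_diff : q - p = S * gi.
Proof.
rewrite -[LHS]mulr1 -[X in _ * X]ggi [LHS]mulrA; congr (_ * _).
rewrite mulrBl {1}/q -mulrA gig mulr1 shift_mul mul_shift.
by rewrite opprB addrC addrA subrK cS.
Qed.

Lemma graph_mid_inv : (q + p - 1) * (g * e) = 1 /\ (g * e) * (q + p - 1) = 1.
Proof.
rewrite graph_mid -!mulrA; split.
  by rewrite [gi * _]mulrA gig mul1r (reflK pp).
by rewrite [e * (e * _)]mulrA (reflK pp) mul1r.
Qed.

Lemma graphK : (q - p) * (g * e) * e = S.
Proof.
by rewrite graph_diff -!mulrA (reflK pp) mulr1 gig mulr1.
Qed.

(** Conjugation by [e] changes the sign of [S * e], so this operator, the adjoint of [g] for
    self-adjoint [p] and [S], is invertible along with [g]. *)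
Lemma coshiftE : 1 - S * e = e * g * e.
Proof.
by rewrite /g (mulrDr e 1) mulr1 (mulrDl e) (reflK pp) mulrA codiag_refl !mulNr -(mulrA S e e) (reflK pp) mulr1.
Qed.

Lemma coshift_inv : (1 - S * e) * (e * gi * e) = 1 /\ (e * gi * e) * (1 - S * e) = 1.
Proof.
rewrite coshiftE; split; rewrite -!mulrA [e * (e * _)]mulrA (reflK pp) mul1r.
  by rewrite [g * _]mulrA ggi mul1r (reflK pp).
by rewrite [gi * _]mulrA gig mul1r (reflK pp).
Qed.

Lemma shift_sqr : S * e * (S * e) = - (S * S).
Proof. by rewrite -mulrA [e * _]mulrA codiag_refl mulNr -mulrA (reflK pp) mulr1 mulrN. Qed.

Lemma coshift_shift : (1 - S * e) * g = 1 + S * S.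
Proof. by rewrite mulrBl mul1r /g (mulrDr (S * e) 1) mulr1 shift_sqr opprD addrA addrK opprK. Qed.

Lemma one_sqr_comm : (1 + S * S) * p = p * (1 + S * S).
Proof. by rewrite mulrDl mulrDr mul1r mulr1 codiag_sqr. Qed.

(** The left-hand side is the adjoint of [q] in the self-adjoint case; it equals [q] because
    [(1 - S * e) * g = 1 + S * S] commutes with [p]. *)
Lemma graph_adjoint_inv : (e * gi * e) * p * (1 - S * e) = q.
Proof.
have [_ hi] := coshift_inv.
rewrite -[LHS]mulr1 -[X in _ * X]ggi /q [LHS]mulrA; congr (_ * _).
rewrite -[_ * p * _ * g]mulrA coshift_shift -mulrA -one_sqr_comm mulrA.
by rewrite -coshift_shift [_ * (_ * g)]mulrA hi mul1r.
Qed.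

(** Trades the inverse [gi], which appears in a product of two graph projections, for the polynomial
    [1 + S]. *)
Lemma mul_one_graph : p * (1 + S) = (1 + S * S) * (p * gi).
Proof.
have -> : p * (1 + S) = p * (1 - S * e).
  rewrite mulrBr mulrDr mulr1; congr (_ + _).
  by rewrite codiagE mulrBr !mulrA codiag_diag pp sub0r opprK.
rewrite mulrA one_sqr_comm -coshift_shift -!mulrA ggi.
by rewrite !mulr1.
Qed.

End backward.

(** * The affine shear of the second coordinate *)

Section shear.
Variables (A : pzRingType) (q n n' ni ni' : A).
Hypotheses (qq : q * q = q).
Hypotheses (qn : q * n = 0) (nq' : n' * q = 0).
Hypotheses (uni : (1 + n) * ni = 1) (niu : ni * (1 + n) = 1).
Hypotheses (uni' : (1 + n') * ni' = 1) (niu' : ni' * (1 + n') = 1).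

Lemma shear_id_mull : q * (1 + n) = q.
Proof. by rewrite mulrDr mulr1 qn addr0. Qed.

Lemma shear_id_mulr : (1 + n') * q = q.
Proof. by rewrite mulrDl mul1r nq' addr0. Qed.

(** The first two terms transform the half [T * q] of a codiagonal [T]; the last two are their
    mirror image on [q * T], which keeps the result self-adjoint when [n'] is the adjoint of [n]. *)
Definition shear_fun n n' T := (1 + n) * T * q + n * q + (q * T * (1 + n') + q * n').
Definition shear_inv ni ni' T := ni * (T * q - n * q) + (q * T - q * n') * ni'.

Section shear_fun.
Variable T : A.
Hypothesis cT : q * T + T * q = T.

Lemma shear_mulr : shear_fun n n' T * q = (1 + n) * T * q + n * q.
Proof.
rewrite mulrDl [X in X + _]mulrDl [X in _ + X]mulrDl.
rewrite -[(1 + n) * T * q * q]mulrA -[n * q * q]mulrA -[q * T * _ * q]mulrA -[q * n' * q]mulrA.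
by rewrite qq shear_id_mulr nq' mulr0 addr0 (codiag_diag qq cT) addr0.
Qed.

Lemma shear_mull : q * shear_fun n n' T = q * T * (1 + n') + q * n'.
Proof.
rewrite mulrDr [X in X + _]mulrDr [X in _ + X]mulrDr !mulrA.
by rewrite shear_id_mull (codiag_diag qq cT) qn mul0r qq !add0r.
Qed.

Lemma shear_codiag : q * shear_fun n n' T + shear_fun n n' T * q = shear_fun n n' T.
Proof. by rewrite shear_mulr shear_mull addrC. Qed.

(** Multiplication by [q] on either side isolates one half of the sheared operator, and each half is
    undone by its own affine inverse. *)
Lemma shear_funK : shear_inv ni ni' (shear_fun n n' T) = T.
Proof.
rewrite /shear_inv shear_mulr shear_mull !addrK -[in RHS]cT addrC.
by rewrite -[q * T * _ * _]mulrA uni' mulr1 !mulrA niu mul1r.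
Qed.

End shear_fun.

Section shear_inv.
Variable T : A.
Hypothesis cT : q * T + T * q = T.

Lemma inv_shear_mul : q * ni = q.
Proof. by rewrite -{1}shear_id_mull -mulrA uni mulr1. Qed.

Lemma mul_inv_shear : ni' * q = q.
Proof. by rewrite -{1}shear_id_mulr mulrA niu' mul1r. Qed.

Lemma shear_inv_mulr : shear_inv ni ni' T * q = ni * (T * q - n * q).
Proof.
rewrite mulrDl -[_ * ni' * q]mulrA mul_inv_shear -[ni * _ * q]mulrA.
rewrite [(_ - n * q) * q]mulrBl -[T * q * q]mulrA -[n * q * q]mulrA qq.
by rewrite mulrBl -[q * n' * q]mulrA nq' mulr0 subr0 (codiag_diag qq cT) addr0.
Qed.

Lemma shear_inv_mull : q * shear_inv ni ni' T = (q * T - q * n') * ni'.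
Proof.
rewrite mulrDr [q * (ni * _)]mulrA inv_shear_mul [q * (_ * ni')]mulrA.
rewrite [q * (q * T - _)]mulrBr [q * (q * T)]mulrA [q * (q * n')]mulrA qq.
by rewrite mulrBr !mulrA qn mul0r subr0 (codiag_diag qq cT) add0r.
Qed.

Lemma shear_inv_codiag :
  q * shear_inv ni ni' T + shear_inv ni ni' T * q = shear_inv ni ni' T.
Proof. by rewrite shear_inv_mulr shear_inv_mull addrC. Qed.

Lemma shear_invK : shear_fun n n' (shear_inv ni ni' T) = T.
Proof.
rewrite /shear_fun -[_ * _ * q]mulrA shear_inv_mulr mulrA uni mul1r subrK.
by rewrite shear_inv_mull -mulrA niu' mulr1 subrK addrC.
Qed.

End shear_inv.

End shear.

(* For graphs of [S] and [T] over [p] and [q], compactness of the product is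
   compactness of the left-hand side; modulo the ideal generated by [p * q] the
   shear makes this condition linear in the new coordinate. *)
Lemma shear_corner (A : pzRingType) (p q n' S T : A) : p * p = p -> q * q = q ->
  n' * q = 0 -> q * T + T * q = T ->
  p * (1 + S) * (1 + T) * q =
  p * shear_fun q ((1 - q) * p * S) n' T * q + p * q * (1 + p * S * (1 + T) * q).
Proof.
move=> pp qq nq' cT; rewrite -[p * shear_fun _ _ _ _ * q]mulrA shear_mulr//.
(* The shear contributes [(1 - q) * z], hence [z - p * q * z] after multiplication by [p]; the last
   summand of the statement restores [p * q * z]. *)
set z := p * S * (1 + T) * q.
have zE : z = p * S * T * q + p * S * q by rewrite /z mulrDr mulr1 mulrDl addrC.
have pz : p * z = z by rewrite /z !mulrA pp.
have -> : (1 + (1 - q) * p * S) * T * q + (1 - q) * p * S * q = T * q + (z - q * z).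
  rewrite [(1 + _) * T]mulrDl mul1r [(T + _) * q]mulrDl -addrA; congr (_ + _).
  transitivity ((1 - q) * z); first by rewrite zE mulrDr !mulrA.
  by rewrite mulrBl mul1r.
rewrite [p * (1 + S)]mulrDr mulr1 [(p + _) * (1 + T)]mulrDl [(_ + _) * q]mulrDl -/z.
rewrite [p * (1 + T)]mulrDr mulr1 [(p + _) * q]mulrDl.
rewrite [p * (T * q + _)]mulrDr [p * (z - _)]mulrBr pz [p * (T * q)]mulrA [p * (q * z)]mulrA.
rewrite [p * q * (1 + z)]mulrDr mulr1 [p * q + p * q * z]addrC addrA.
by rewrite -(addrA (p * T * q)) subrK -[LHS]addrA addrC.
Qed.

(** * Projections as graphs *)

Section norm_closed.
Variable R : realType.
Implicit Types E F : normedModType R.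

Lemma norm_closedI E (K L : set E) : norm_closed K -> norm_closed L -> norm_closed (K `&` L).
Proof.
move=> cK cL x KLx; split; [apply: cK|apply: cL] => e /KLx[y [Ky Ly] xy].
  by exists y.
by exists y.
Qed.

Lemma norm_closed_preimage E F (L : clin E F) (K : set F) :
  norm_closed K -> norm_closed (L @^-1` K).
Proof.
move=> cK x Kx; apply: cK => e e0.
have L0 : 0 < `|L| + 1 by rewrite ltr_wpDl.
have [y Ky xy] := Kx _ (divr_gt0 e0 L0); exists (L y) => //.
rewrite -linearB; apply: le_lt_trans (clin_norm_bound _ _) _.
apply: (@le_lt_trans _ _ ((`|L| + 1) * `|x - y|)).
  by rewrite ler_wpM2r// lerDl.
by rewrite mulrC -ltr_pdivlMr.
Qed.

Lemma norm_closed_set0 E : norm_closed [set 0 : E].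
Proof.
move=> x Hx; apply/eqP; rewrite -normr_le0; apply/ler_addgt0Pr => e /Hx[_ -> +].
by rewrite subr0 add0r => /ltW.
Qed.

End norm_closed.

(** * Graph projections and compactness of their products *)

Section local_model.
Variables (R : realType) (H : completeNormedModType R[i]).
Variable dot : {dot H for Num.conj}.
Hypothesis dot_norm : forall x : H, dot x x = `|x| ^+ 2.
Implicit Types p q S T g k : bop H.

Local Notation G := (bop H * bop H)%type.

Lemma bop_mulZr (a : R) S T : S * (a *: T) = a *: (S * T).
Proof. exact: (linearZ_LR (bbil_left (bop_bbil H) S)). Qed.

Lemma bop_mulZl (a : R) S T : (a *: S) * T = a *: (S * T).
Proof. exact: (linearZ_LR (bbil_right (bop_bbil H) T)). Qed.

Lemma orthogonal_projectionP p :
  orthogonal_projection dot p <-> p * p = p /\ adjoint dot p p.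
Proof.
split=> -[pp ap]; split=> //; first by apply/val_inj/funext => x /=; exact: pp.
by move=> x; rewrite -{3}pp.
Qed.

Lemma finite_dimensional_image T (V : set H) :
  finite_dimensional V -> finite_dimensional (T @` V).
Proof.
move=> [n [e ->]]; exists n, (T \o e); apply/seteqP; split.
  move=> _ [_ [a ->] <-]; exists a; rewrite linear_sum.
  by apply: eq_bigr => i _; rewrite linearZ.
move=> _ [a ->]; exists (\sum_(i < n) a i *: e i); first by exists a.
by rewrite linear_sum; apply: eq_bigr => i _; rewrite linearZ.
Qed.

(** The range and the kernel of [p] are the images under [gi] of those of the conjugate, so finite
    dimension would carry back to [p]. *)
Lemma Pinf_similar p g gi : g * gi = 1 -> gi * g = 1 -> Pinf dot p ->
  orthogonal_projection dot (g * p * gi) -> Pinf dot (g * p * gi).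
Proof.
move=> ggi gig [_ rp kp] oq.
have K1 x : g (gi x) = x by rewrite -[LHS]/((g * gi) x) ggi.
have K2 x : gi (g x) = x by rewrite -[LHS]/((gi * g) x) gig.
split=> // /(finite_dimensional_image gi) fd; [apply: rp|apply: kp].
  suff -> : range p = gi @` range (g * p * gi) by [].
  apply/seteqP; split.
    move=> _ [x _ <-]; exists (g (p x)); last exact: K2.
    by exists (g x) => //=; rewrite K2.
  by move=> _ [_ [x _ <-] <-]; exists (gi x) => //=; rewrite K2.
suff -> : [set x | p x = 0] = gi @` [set x | (g * p * gi) x = 0] by [].
apply/seteqP; split.
  by move=> x /= px; exists (g x) => //; rewrite K2 px linear0.
move=> _ [x /= gx <-].
by rewrite -[LHS]K2 gx linear0.
Qed.

Section one_graph.
Variables (p S : bop H).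
Hypotheses (pp : p * p = p) (ap : adjoint dot p p).
Hypotheses (aS : adjoint dot S S) (cS : p * S + S * p = S).
Let g := 1 + S * refl p.
Hypothesis ug : bunit g.

(** Its range is the graph of [S] over the range of [p], because [(1 + S * refl p) * p = p + S * p]
    for idempotent [p]. *)
Definition graph_proj p S := (1 + S * refl p) * p * binv (1 + S * refl p).

Lemma adjoint_refl p' : adjoint dot p' p' -> adjoint dot (refl p') (refl p').
Proof. by move=> a; apply: adjointB; [exact: adjointD|exact: adjoint1]. Qed.

Lemma graph_proj_orthogonal : orthogonal_projection dot (graph_proj p S).
Proof.
apply/orthogonal_projectionP; split.
  exact: (graph_idem pp (binv_mul ug)).
have [h1 h2] := coshift_inv pp cS (mul_binv ug) (binv_mul ug).
have ug' : bunit (1 - S * refl p) by exact: bunitP h1 h2.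
have ag : adjoint dot g (1 - S * refl p).
  rewrite -(codiag_refl cS); apply: adjointD; first exact: adjoint1.
  exact: adjointM aS (adjoint_refl ap).
have := adjointM (adjointM ag ap) (adjointV ag ug ug').
by rewrite (binvE h1 h2) mulrA (graph_adjoint_inv pp cS (mul_binv ug) (binv_mul ug)).
Qed.

Lemma graph_proj_mid : bunit (graph_proj p S + p - 1).
Proof. by have [h1 h2] := graph_mid_inv pp cS (mul_binv ug) (binv_mul ug); exact: bunitP h1 h2. Qed.

Lemma graph_projK :
  (graph_proj p S - p) * binv (graph_proj p S + p - 1) * refl p = S.
Proof.
have [h1 h2] := graph_mid_inv pp cS (mul_binv ug) (binv_mul ug).
by rewrite (binvE h1 h2) (graphK pp cS (mul_binv ug) (binv_mul ug)).
Qed.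

Lemma graph_proj_Pinf : Pinf dot p -> Pinf dot (graph_proj p S).
Proof.
move=> Pp; apply: (Pinf_similar (mul_binv ug) (binv_mul ug) Pp).
exact: graph_proj_orthogonal.
Qed.

End one_graph.

Section one_coordinate.
Variables (p P : bop H).
Hypotheses (pp : p * p = p) (ap : adjoint dot p p).
Hypotheses (PP : P * P = P) (aP : adjoint dot P P).
Hypothesis uP : bunit (P + p - 1).

Definition graph_coord p P := (P - p) * binv (P + p - 1) * refl p.

Lemma graph_coord_adj : adjoint dot (graph_coord p P) (graph_coord p P).
Proof.
have aD : adjoint dot (P - p) (P - p) by exact: adjointB.
have aA : adjoint dot (P + p - 1) (P + p - 1) by apply: adjointB; [exact: adjointD|exact: adjoint1].
have := adjointM (adjointM aD (adjointV aA uP uP)) (adjoint_refl ap).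
by rewrite mulrA (graph_adjoint pp PP (mul_binv uP) (binv_mul uP)).
Qed.

Lemma graph_coord_codiag : p * graph_coord p P + graph_coord p P * p = graph_coord p P.
Proof. exact: graph_codiag pp PP (mul_binv uP) (binv_mul uP). Qed.

Lemma graph_coord_unit : bunit (1 + graph_coord p P * refl p).
Proof.
rewrite (graph_shift pp (mul_binv uP)); apply: bunitM; last exact: bunitV.
by apply: (@bunitP _ _ _ (refl P)); exact: reflK.
Qed.

Lemma graph_coordK : graph_proj p (graph_coord p P) = P.
Proof.
rewrite /graph_proj (graph_shift_mul pp PP (mul_binv uP) (binv_mul uP)).
by rewrite -[LHS]mulrA mul_binv ?mulr1//; exact: graph_coord_unit.
Qed.

End one_coordinate.

(** Invertible outer factors do not affect compactness. Stripping them from the product leaves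
    [p * (1 + S) * (1 + T) * q], and [shear_corner] compares this with the linear corner up to a
    multiple of the compact [p * q]. *)
Lemma kop_graph p q S T n' : p * p = p -> q * q = q ->
  p * S + S * p = S -> q * T + T * q = T -> n' * q = 0 ->
  bunit (1 + S * refl p) -> bunit (1 + T * refl q) -> kop (p * q) ->
  kop (graph_proj p S * graph_proj q T) <->
  kop (p * shear_fun q ((1 - q) * p * S) n' T * q).
Proof.
move=> pp qq cS cT nq' ug uk kpq.
set g := 1 + S * refl p in ug *; set k := 1 + T * refl q in uk *.
pose gi := binv g; pose ki := binv k.
have ggi : g * gi = 1 by exact: mul_binv.
have gig : gi * g = 1 by exact: binv_mul.
have kki : k * ki = 1 by exact: mul_binv.
have kik : ki * k = 1 by exact: binv_mul.
have e1 : graph_proj p S * graph_proj q T = g * (p * gi * k * q) * ki.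
  by rewrite /graph_proj -/g -/k -/gi -/ki !mulrA.
have e2 : p * gi * k * q = gi * (graph_proj p S * graph_proj q T) * k.
  by rewrite e1 !mulrA gig mul1r -!mulrA kik mulr1.
have e3 : (1 + S * S) * (p * gi * k * q) = p * (1 + S) * (1 + T) * q.
  rewrite (mul_one_graph pp cS ggi) -!mulrA; do 3!congr (_ * _).
  by rewrite (shift_mul T qq) mulrDl mul1r.
have [h1 h2] := coshift_inv pp cS ggi gig.
(* This is [e3] solved for the inner factor: [1 + S * S] is the product of the invertible
   [1 - S * refl p] and [g]. *)
have e4 : p * gi * k * q = gi * (refl p * gi * refl p) * (p * (1 + S) * (1 + T) * q).
  have hw : gi * (refl p * gi * refl p) * ((1 - S * refl p) * g) = 1.
    rewrite -[LHS]mulrA; set h := refl p * gi * refl p in h2 *.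
    by rewrite [h * _]mulrA h2 mul1r.
  by rewrite -e3 -(coshift_shift pp cS) -/g [RHS]mulrA hw mul1r.
have e5 := shear_corner S pp qq nq' cT.
split=> [kPQ|kY].
  have -> : p * shear_fun q ((1 - q) * p * S) n' T * q =
     (1 + S * S) * (gi * (graph_proj p S * graph_proj q T) * k) +
     - (p * q * (1 + p * S * (1 + T) * q)).
    by rewrite -e2 e3 e5 addrK.
  by apply: kopD; [apply/kopMl/kopMr/kopMl|apply/kopN/kopMr].
rewrite e1; apply: kopMr; apply: kopMl; rewrite e4; apply: kopMl; rewrite e5.
by apply: kopD; [|exact: kopMr].
Qed.

End local_model.

(** * The chart around a given pair *)

Section chart_at.
Variables (R : realType) (H : completeNormedModType R[i]).
Variable dot : {dot H for Num.conj}.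
Hypothesis dot_norm : forall x : H, dot x x = `|x| ^+ 2.
Variables p q : bop H.
Hypothesis Cpq : Cprime dot (p, q).
Implicit Types S T : bop H.

Local Notation G := (bop H * bop H)%type.

Fact base_l : p * p = p /\ adjoint dot p p.
Proof. by case: Cpq => -[/orthogonal_projectionP]. Qed.

Fact base_r : q * q = q /\ adjoint dot q q.
Proof. by case: Cpq => _ [/orthogonal_projectionP]. Qed.

Fact base_kop : kop (p * q). Proof. by case: Cpq. Qed.

Let pp : p * p = p := base_l.1.
Let ap : adjoint dot p p := base_l.2.
Let qq : q * q = q := base_r.1.
Let aq : adjoint dot q q := base_r.2.

(** Expresses the codiagonal condition as the kernel of a bounded linear map, so that it is
    closed. *)
Definition codiag_clin r : clin (bop H) (bop H) :=
  bbil_left (bop_bbil H) r + bbil_right (bop_bbil H) r + clin_opp (bop H).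

Lemma codiag_clinP r S : codiag_clin r S = 0 <-> r * S + S * r = S.
Proof.
have -> : codiag_clin r S = r * S + S * r - S by [].
by split => [/eqP|->]; [rewrite subr_eq0 => /eqP|rewrite subrr].
Qed.

Definition corner_clin : clin (bop H) (bop H) :=
  clin_comp (bbil_left (bop_bbil H) p) (bbil_right (bop_bbil H) q).

Definition chart_model_set : set G := [set y | [/\ adjoint dot y.1 y.1,
  p * y.1 + y.1 * p = y.1, adjoint dot y.2 y.2, q * y.2 + y.2 * q = y.2 &
  kop (p * y.2 * q)]].

Lemma chart_model_set_submod : submod_closed (mem chart_model_set).
Proof.
split.
  by apply/mem_set; split; rewrite /= ?mulr0 ?mul0r ?mulr0 ?addr0;
    [exact: adjoint0|by []|exact: adjoint0|by []|exact: kop0].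
move=> a u v /set_mem[a1 c1 a2 c2 k] /set_mem[a1' c1' a2' c2' k'].
apply/mem_set; split => /=.
- by apply: adjointD => //; exact: adjointZ.
- by rewrite mulrDr mulrDl bop_mulZr bop_mulZl addrACA -scalerDr c1 c1'.
- by apply: adjointD => //; exact: adjointZ.
- by rewrite mulrDr mulrDl bop_mulZr bop_mulZl addrACA -scalerDr c2 c2'.
- by rewrite mulrDr mulrDl bop_mulZr bop_mulZl; apply: kopD => //; exact: kopZ.
Qed.

Lemma chart_model_set_closed : norm_closed chart_model_set.
Proof.
pose A := [set S : bop H | adjoint dot S S].
have -> : chart_model_set =
    ((clin_fst (bop H) (bop H) : G -> bop H) @^-1` A `&`
     (clin_comp (codiag_clin p) (clin_fst _ _) : G -> bop H) @^-1` [set 0]) `&`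
    ((clin_snd (bop H) (bop H) : G -> bop H) @^-1` A `&`
     (clin_comp (codiag_clin q) (clin_snd _ _) : G -> bop H) @^-1` [set 0] `&`
     (clin_comp corner_clin (clin_snd _ _) : G -> bop H) @^-1` [set T | kop T]).
  apply/seteqP; split => [y [a1 c1 a2 c2 k]|y [[a1 c1] [[a2 c2] k]]].
    split; first by split => //; exact/codiag_clinP.
    by split; [split => //; exact/codiag_clinP|rewrite /= mulrA].
  by split => //; exact/codiag_clinP.
have cA : norm_closed A by exact: adjoint_closed.
by do !apply: norm_closedI; apply: norm_closed_preimage;
  [|exact: norm_closed_set0| |exact: norm_closed_set0|exact: kop_closed].
Qed.

Definition chart_model : closed_submodule G :=
  ClosedSubmodule chart_model_set_submod chart_model_set_closed (@prod_cauchy_cvg R (bop H) (bop H)).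

(** The operator [n] of the shear; [shr S] is its adjoint for self-adjoint [S]. The factor [1 - q]
    gives [q * shl S = 0], as the shear identities require. *)
Definition shl S := (1 - q) * p * S.
Definition shr S := S * p * (1 - q).

Lemma mul_shl S : q * shl S = 0.
Proof. by rewrite /shl !mulrA mulrBr mulr1 qq subrr !mul0r. Qed.

Lemma shr_mul S : shr S * q = 0.
Proof. by rewrite /shr -!mulrA mulrBl mul1r qq subrr !mulr0. Qed.

Lemma adjoint_shl S : adjoint dot S S -> adjoint dot (shl S) (shr S).
Proof.
move=> aS; rewrite /shl /shr -(mulrA S); apply: adjointM => //; apply: adjointM => //.
by apply: adjointB => //; exact: adjoint1.
Qed.

Definition chart_fun (x : G) : G :=
  (graph_coord p x.1, shear_fun q (shl (graph_coord p x.1)) (shr (graph_coord p x.1))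
                        (graph_coord q x.2)).

Definition unshear (y : G) : bop H :=
  shear_inv q (shl y.1) (shr y.1) (binv (1 + shl y.1)) (binv (1 + shr y.1)) y.2.

Definition chart_inv (y : G) : G := (graph_proj p y.1, graph_proj q (unshear y)).

Lemma adjoint_shear S T : adjoint dot S S -> adjoint dot T T ->
  adjoint dot (shear_fun q (shl S) (shr S) T) (shear_fun q (shl S) (shr S) T).
Proof.
move=> aS aT; have an := adjoint_shl aS; have an' := adjoint_sym an.
rewrite [X in adjoint _ _ X]addrC; apply: adjointD; apply: adjointD.
- rewrite -[X in adjoint _ _ X]mulrA; apply: adjointM aq; apply: adjointM aT.
  exact: adjointD (@adjoint1 _ _ _) an.
- exact: adjointM an aq.
- rewrite -[X in adjoint _ X _]mulrA; apply: adjointM aq _; apply: adjointM aT _.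
  exact: adjointD (@adjoint1 _ _ _) an'.
- exact: adjointM aq an'.
Qed.

Lemma adjoint_unshear y : adjoint dot y.1 y.1 -> adjoint dot y.2 y.2 ->
  bunit (1 + shl y.1) -> bunit (1 + shr y.1) -> adjoint dot (unshear y) (unshear y).
Proof.
move=> aS aY un un'; have an := adjoint_shl aS; have an' := adjoint_sym an.
rewrite [X in adjoint _ _ X]addrC; apply: adjointD; apply: adjointM.
- by apply: adjointV un un'; exact: adjointD (@adjoint1 _ _ _) an.
- exact: adjointB (adjointM aY aq) (adjointM an aq).
- exact: adjointB (adjointM aq aY) (adjointM aq an').
- by apply: adjointV un' un; exact: adjointD (@adjoint1 _ _ _) an'.
Qed.

(** Nested preimages starting from the whole space, so that openness follows by repeated use of
    [smooth_preimage_open]. *)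
Definition dom0 : set G :=
  ([set: G] `&` (fun x : G => x.1 + p - 1) @^-1` @bunit R H) `&`
  (fun x : G => x.2 + q - 1) @^-1` @bunit R H.

Definition cod0 : set G :=
  (([set: G] `&` (fun y : G => 1 + y.1 * refl p) @^-1` @bunit R H) `&`
   (fun y : G => 1 + shl y.1) @^-1` @bunit R H) `&`
  (fun y : G => 1 + shr y.1) @^-1` @bunit R H.

Lemma smooth_fst (U : set G) : open U -> smooth U (fun x => x.1).
Proof. by move=> oU; exact: (smooth_clin oU (clin_fst _ _)). Qed.

Lemma smooth_snd (U : set G) : open U -> smooth U (fun x => x.2).
Proof. by move=> oU; exact: (smooth_clin oU (clin_snd _ _)). Qed.

Lemma smooth_shl (U : set G) (f : G -> bop H) : open U -> smooth U f ->
  smooth U (fun x => shl (f x)).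
Proof. by move=> oU sf; apply: smoothM => //; exact: smooth_cst. Qed.

Lemma smooth_shr (U : set G) (f : G -> bop H) : open U -> smooth U f ->
  smooth U (fun x => shr (f x)).
Proof.
move=> oU sf; apply: smoothM => //; last exact: smooth_cst.
by apply: smoothM => //; exact: smooth_cst.
Qed.

Lemma smooth_mid (U : set G) r (f : G -> bop H) : open U -> smooth U f ->
  smooth U (fun x => f x + r - 1).
Proof.
move=> oU sf; apply: smoothB => //; last exact: smooth_cst.
by apply: smoothD => //; exact: smooth_cst.
Qed.

Lemma smooth_one_plus (U : set G) (f : G -> bop H) : open U -> smooth U f ->
  smooth U (fun x => 1 + f x).
Proof. by move=> oU sf; apply: smoothD => //; exact: smooth_cst. Qed.

Lemma smooth_shift (U : set G) r (f : G -> bop H) : open U -> smooth U f ->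
  smooth U (fun x => 1 + f x * refl r).
Proof.
by move=> oU sf; apply: smooth_one_plus => //; apply: smoothM => //; exact: smooth_cst.
Qed.

Lemma dom0_open : open dom0.
Proof.
have o1 : open ([set: G] `&` (fun x : G => x.1 + p - 1) @^-1` @bunit R H).
  apply: smooth_preimage_open (@bunit_open R H); [exact: openT|].
  by apply: smooth_mid; [exact: openT|apply: smooth_fst; exact: openT].
apply: smooth_preimage_open (@bunit_open R H) => //.
by apply: smooth_mid => //; exact: smooth_snd.
Qed.

Lemma cod0_open : open cod0.
Proof.
have o1 : open ([set: G] `&` (fun y : G => 1 + y.1 * refl p) @^-1` @bunit R H).
  apply: smooth_preimage_open (@bunit_open R H); [exact: openT|].
  by apply: smooth_shift; [exact: openT|apply: smooth_fst; exact: openT].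
have o2 : open (([set: G] `&` (fun y : G => 1 + y.1 * refl p) @^-1` @bunit R H) `&`
   (fun y : G => 1 + shl y.1) @^-1` @bunit R H).
  apply: smooth_preimage_open (@bunit_open R H) => //.
  by apply: smooth_one_plus => //; apply: smooth_shl => //; exact: smooth_fst.
apply: smooth_preimage_open (@bunit_open R H) => //.
by apply: smooth_one_plus => //; apply: smooth_shr => //; exact: smooth_fst.
Qed.

Lemma smooth_graph_coord (U : set G) r (f : G -> bop H) : open U ->
  (forall x, U x -> bunit (f x + r - 1)) -> smooth U f ->
  smooth U (fun x => graph_coord r (f x)).
Proof.
move=> oU uf sf; apply: smoothM => //; last exact: smooth_cst.
apply: smoothM => //; first by apply: smoothB => //; exact: smooth_cst.
by apply: smooth_binv => //; exact: smooth_mid.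
Qed.

Lemma smooth_graph_proj (U : set G) r (f : G -> bop H) : open U ->
  (forall x, U x -> bunit (1 + f x * refl r)) -> smooth U f ->
  smooth U (fun x => graph_proj r (f x)).
Proof.
move=> oU uf sf; apply: smoothM => //.
  by apply: smoothM => //; [exact: smooth_shift|exact: smooth_cst].
by apply: smooth_binv => //; exact: smooth_shift.
Qed.

Lemma chart_fun_smooth : smooth dom0 chart_fun.
Proof.
have oU := dom0_open.
have s1 : smooth dom0 (fun x => graph_coord p x.1).
  by apply: smooth_graph_coord => //; [move=> x [[]]|exact: smooth_fst].
have s2 : smooth dom0 (fun x => graph_coord q x.2).
  by apply: smooth_graph_coord => //; [move=> x []|exact: smooth_snd].
have sn := smooth_shl oU s1; have sn' := smooth_shr oU s1.
have sq : smooth dom0 (fun=> q) by exact: smooth_cst.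
apply: smooth_pair => //; apply: smoothD => //; apply: smoothD => //; apply: smoothM => //.
- by apply: smoothM => //; exact: smooth_one_plus.
- by apply: smoothM.
- exact: smooth_one_plus.
Qed.

Lemma unshear_smooth : smooth cod0 unshear.
Proof.
have oU := cod0_open.
have s1 := smooth_fst oU; have s2 := smooth_snd oU.
have sn := smooth_shl oU s1; have sn' := smooth_shr oU s1.
have sq : smooth cod0 (fun=> q) by exact: smooth_cst.
apply: smoothD => //; apply: smoothM => //.
- by apply: smooth_binv => //; [move=> y [[_]]|exact: smooth_one_plus].
- by apply: smoothB => //; exact: smoothM.
- by apply: smoothB => //; exact: smoothM.
- by apply: smooth_binv => //; [move=> y []|exact: smooth_one_plus].
Qed.

(** The last condition is imposed on top of [cod0] because [unshear] is shown to be smooth only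
    there. *)
Definition chart_cod : set G := cod0 `&` (fun y => 1 + unshear y * refl q) @^-1` @bunit R H.

Lemma cod_open : open chart_cod.
Proof.
apply: smooth_preimage_open (@bunit_open R H); first exact: cod0_open.
by apply: smooth_shift; [exact: cod0_open|exact: unshear_smooth].
Qed.

Lemma chart_inv_smooth : smooth chart_cod chart_inv.
Proof.
have oU := cod_open.
apply: smooth_pair => //.
  by apply: smooth_graph_proj => //; [move=> x [[[[]]]]|exact: smooth_fst].
apply: smooth_graph_proj => //; first by move=> x [].
by apply: smooth_sub unshear_smooth => x [].
Qed.

(** Cut down to the preimage of the codomain, so that [chart_fun] lands in [chart_cod] by
    construction. *)
Definition chart_dom : set G := dom0 `&` chart_fun @^-1` chart_cod.

Lemma dom_open : open chart_dom.
Proof. by apply: smooth_preimage_open cod_open; [exact: dom0_open|exact: chart_fun_smooth]. Qed.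

Lemma chart_funP x : Cprime dot x -> chart_dom x ->
  [/\ chart_cod (chart_fun x), csub_set chart_model (chart_fun x) & chart_inv (chart_fun x) = x].
Proof.
case: x => P Q [PP QQ kPQ] [[[_ uP] uQ] Vx].
have {}uP : bunit (P + p - 1) by [].
have {}uQ : bunit (Q + q - 1) by [].
have [[oP _ _] [oQ _ _]] := (PP, QQ).
have [PPP aP] := (orthogonal_projectionP dot P).1 oP.
have [QQQ aQ] := (orthogonal_projectionP dot Q).1 oQ.
set S := graph_coord p P; set T := graph_coord q Q.
have aS : adjoint dot S S by exact: graph_coord_adj.
have aT : adjoint dot T T by exact: graph_coord_adj.
have cS : p * S + S * p = S by exact: graph_coord_codiag.
have cT : q * T + T * q = T by exact: graph_coord_codiag.
have [[[[_ ug] un] un'] uk] := Vx.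
have TE : unshear (chart_fun (P, Q)) = T.
  by apply: (shear_funK qq (mul_shl S) (shr_mul S)) => //; [exact: binv_mul|exact: mul_binv].
have PK : graph_proj p S = P by exact: graph_coordK.
have QK : graph_proj q T = Q by exact: graph_coordK.
split; [exact: Vx| |by rewrite /chart_inv TE; congr pair].
have uk' : bunit (1 + T * refl q) by rewrite -TE.
have cY := shear_codiag qq (mul_shl S) (shr_mul S) cT.
have kY : kop (p * shear_fun q (shl S) (shr S) T * q).
  by apply/(kop_graph pp qq cS cT (shr_mul S) ug uk' base_kop); rewrite PK QK.
have aY := adjoint_shear aS aT.
exact: (And5 aS cS aY cY kY).
Qed.

Lemma chart_invP y : csub_set chart_model y -> chart_cod y ->
  [/\ chart_dom (chart_inv y), Cprime dot (chart_inv y) & chart_fun (chart_inv y) = y].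
Proof.
case: y => S Y [/= aS cS aY cY kY] Vy.
have [[[[_ /= ug] /= un] /= un'] uk] := Vy.
set T := unshear (S, Y); rewrite -/T in uk.
have cT : q * T + T * q = T.
  exact: (shear_inv_codiag qq (mul_shl S) (shr_mul S) (mul_binv un) (binv_mul un') cY).
have aT : adjoint dot T T.
  exact: adjoint_unshear.
have Sp : graph_coord p (graph_proj p S) = S by exact: graph_projK.
have Tq : graph_coord q (graph_proj q T) = T by exact: graph_projK.
have shT : shear_fun q (shl S) (shr S) T = Y.
  exact: (shear_invK qq (mul_shl S) (shr_mul S) (mul_binv un) (binv_mul un') cY).
have fK : chart_fun (chart_inv (S, Y)) = (S, Y).
  by rewrite /chart_fun /chart_inv /= Sp Tq shT.
split => //.
  split; last by rewrite /= fK.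
  by split; [split => //|]; exact: graph_proj_mid.
have [Pp Pq _] := Cpq.
split; [exact: graph_proj_Pinf|exact: graph_proj_Pinf|].
have kT : kop (p * shear_fun q (shl S) (shr S) T * q) by rewrite shT.
exact: ((kop_graph pp qq cS cT (shr_mul S) ug uk base_kop).2 kT).
Qed.

Definition chart_straightening : straightening (Cprime dot) :=
  Straightening dom_open cod_open (smooth_sub (fun x => @proj1 _ _) chart_fun_smooth)
    chart_inv_smooth chart_funP chart_invP.

Lemma graph_coord_base (r : bop H) : graph_coord r r = 0.
Proof. by rewrite /graph_coord subrr !mul0r. Qed.

(** At the base pair both coordinates and the shear operators vanish, so the elements required to be
    invertible are [refl p], [refl q] and 1. *)
Lemma base_in_dom : chart_dom (p, q).
Proof.
have ur r : r * r = r -> bunit (r + r - 1).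
  by move=> rr; apply: bunitP; exact: reflK.
split; first by split; [split => //|]; exact: ur.
have n0 : shl 0 = 0 by rewrite /shl mulr0.
have n0' : shr 0 = 0 by rewrite /shr !mul0r.
have f0 : chart_fun (p, q) = (0, 0).
  by rewrite /chart_fun /= !graph_coord_base n0 n0' /shear_fun !(mulr0, mul0r, addr0).
have T0 : unshear (0, 0) = 0.
  by rewrite /unshear /= n0 n0' /shear_inv !(mulr0, mul0r, subr0, addr0).
rewrite /= f0; split; last by rewrite /= T0 mul0r addr0; exact: bunit1.
by split; [split; [split => //|]|]; rewrite /= ?n0 ?n0' ?mul0r addr0; exact: bunit1.
Qed.

End chart_at.

(* The carrier of the manifold is the subtype of the set [Cprime dot] of the
   normed space [bop H * bop H], with the induced topology. *)
Theorem theorem8p5 (R : realType) (H : completeNormedModType R[i])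
  (dot : {dot H for Num.conj})
  (dot_norm : forall x : H, dot x x = `|x| ^+ 2)
  (H_separable : exists2 D : set H, countable D & dense D)
  (H_infinite : ~ finite_dimensional [set: H]) :
  smooth_banach_manifold R (set_type (Cprime dot)).
Proof.
apply: straightening_manifold => -[p q] Cpq.
by exists (chart_straightening dot_norm Cpq); exact: (base_in_dom Cpq).
Qed.
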